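(* Suppose Assumption (NKL) holds. Let $f^n=(f_i^n)_i$ and $f^\dagger=(f_i^\dagger)_i$ in $Y$ be such that, as $n\to\infty$, $\|f_i^\dagger-f_i^n\|_2\to0$ for $i\in L_{\mathrm{nr}}$ and $D_{\mathrm{KL}}(f_i^\dagger,f_i^n)+\|f_i^\dagger-f_i^n\|_1\to0$ for $i\in L_{\mathrm{kl}}$, and take $\lambda\in(0,\infty)^N$. In case $J_\lambda(\cdot,f^n)$ is proper (finite in at least one point), there exists a solution to $\min_{u\in L^p(\Omega)^N}J_\lambda(u,f^n)$. If we further assume that, for some solution $u_0$ of $\min_{u\in L^p(\Omega)^N}J_\lambda(u,f^\dagger)$ with $J_\lambda(u_0,f^\dagger)<\infty$, for each $i\in L_{\mathrm{kl}}$ there exist $\beta_0,\beta_1>0$ such that $\beta_0f_i^\dagger\ge T_i(u_0)_i+c_i\ge\beta_1f_i^\dagger$ a.e., then every sequence $(u^n)_n$ of solutions to $$\min_{u\in L^p(\Omega)^N}J_\lambda(u,f^n)$$ admits a subsequence, again denoted by $(u^n)_n$, converging weakly in $L^p(\Omega)^N$ to a limit $u^\dagger$ such that $$\lim_{n\to\infty}\|T_iu_i^n-f_i^n\|_2^2=\|T_iu_i^\dagger-f_i^\dagger\|_2^2\quad\text{for all }i\in L_{\mathrm{nr}},$$ $$\lim_{n\to\infty}D_{\mathrm{KL}}(T_iu_i^n+c_i,f_i^n)=D_{\mathrm{KL}}(T_iu_i^\dagger+c_i,f_i^\dagger)\quad\text{for all }i\in L_{\mathrm{kl}},$$ $$\lim_{n\to\infty}R(u^n)=R(u^\dagger),$$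 and every weak $L^p$ limit of a weakly convergent subsequence of solutions is a solution to $$\min_{u\in L^p(\Omega)^N}J_\lambda(u,f^\dagger).$$
   Context: Setting. $\{1,\dots,N\}$ is the disjoint union of $L_{\mathrm{nr}}$ and $L_{\mathrm{kl}}$; $\Omega\subset\mathbb R^d$ is a bounded Lipschitz domain; $p\in(1,2]$; $R\colon L^p(\Omega)^N\to[0,\infty]$; elements of $L^p(\Omega)^N$ are written $u=(u_1,\dots,u_N)$. For $i\in L_{\mathrm{nr}}$, $\Sigma_i\subset\mathbb R^{m_i}$ is bounded and Lebesgue measurable and $Y_i=L^p(\Sigma_i)$; for $i\in L_{\mathrm{kl}}$, $(\Sigma_i,\mathcal B_{\mu_i},\mu_i)$ is a finite measure space with $\Sigma_i\subset\mathbb R^{m_i}$, $Y_i=L^1(\Sigma_i,\mu_i)$, and $c_i\in L^1(\Sigma_i,\mu_i)$ is given with $c_i\ge0$. $Y=Y_1\times\cdots\times Y_N$. Put $$J_\lambda(u,f)=R(u)+\sum_{i\in L_{\mathrm{nr}}}\lambda_i\|T_iu_i-f_i\|_2^2+\sum_{i\in L_{\mathrm{kl}}}\lambda_iD_{\mathrm{KL}}(T_iu_i+c_i,f_i).$$ For $v\in L^p(\Sigma_i)$, $\|v\|_2=\sup\{\int_{\Sigma_i}v\phi:\phi\in C_c^\infty(\Sigma_i),\ \|\phi\|_2\le1\}$ (so this is the $L^2$ norm if $v\in L^2(\Sigma_i)$ and $\infty$ otherwise). The Kullback-Leibler divergence is $D_{\mathrm{KL}}(v,f)=\int_\Sigma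 v-f-f\log(\frac vf)\,d\mu$ if $v\ge0,f\ge0$ a.e., and $\infty$ else, with $0\log(\frac a0)=0$ for $a\ge0$ and $-b\log(\frac0b)=\infty$ for $b>0$. Assumption (NKL): (1) $R$ is lower semi-continuous w.r.t. weak convergence in $L^p(\Omega)^N$. (2) $T_i\colon L^p(\Omega)\to L^p(\Sigma_i)$ for $i\in L_{\mathrm{nr}}$ and $T_i\colon L^p(\Omega)\to L^1(\Sigma_i,\mu_i)$ for $i\in L_{\mathrm{kl}}$ are bounded linear operators. (3) For each $C>0$, every sequence in $\{u\in L^p(\Omega)^N: R(u)+\sum_{i\in L_{\mathrm{nr}}}\|T_iu_i\|_p+\sum_{i\in L_{\mathrm{kl}}}\|T_iu_i\|_1<C\}$ has a subsequence converging weakly in $L^p(\Omega)^N$. *)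

(* Defs.v *)
From HB Require Import structures.
From mathcomp Require Import all_boot all_order all_algebra.
From mathcomp Require Import all_classical all_reals all_analysis.

Set Implicit Arguments.
Unset Strict Implicit.
Unset Printing Implicit Defensive.

Import Order.TTheory GRing.Theory Num.Def Num.Theory.
Import numFieldNormedType.Exports.

Local Open Scope classical_set_scope.
Local Open Scope ring_scope.

Definition caratheodory_measure_of {R : realType} {T : pointedType}
    (mu : {outer_measure set T -> \bar R}) :
    {measure set (caratheodory_type mu) -> \bar R} :=
  [the measure _ _ of mu : set (caratheodory_type mu) -> \bar R].

Section LebesgueRn.
Context {R : realType} {n : nat}.
Local Open Scope ereal_scope.
Implicit Types (A D X : set 'rV[R]_n) (a b : 'rV[R]_n).

Definition closed_box a b : set 'rV[R]_n :=
  [set x | forall i, (a ord0 i <= x ord0 i <= b ord0 i)%R].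

(* The volume of a nonempty closed box, 0 for the empty set (which is not a
   box when n = 0), and +oo for every other set, where the infimum is taken
   over the empty set *)
Definition box_volume A : \bar R :=
  ereal_inf [set v | A = set0 /\ v = 0 \/
    exists a b, [/\ forall i, (a ord0 i <= b ord0 i)%R, A = closed_box a b &
      v = (\prod_(i < n) (b ord0 i - a ord0 i))%R%:E]].

Definition lebesgue_outer X : \bar R :=
  ereal_inf [set \sum_(k <oo) box_volume (F k) | F in
    [set F : (set 'rV[R]_n)^nat | X `<=` \bigcup_k F k]].

Let discr := g_sigma_algebraType [set: set 'rV[R]_n].

Let box_volume_ge0 A : 0 <= box_volume A.
Proof.
apply: le_ereal_inf_tmp => _ [[_ ->//]|[a [b [ab _ ->]]]].
by rewrite lee_fin; apply: prodr_ge0 => i _; rewrite subr_ge0.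
Qed.

Let box_volume0 : box_volume set0 = 0.
Proof.
apply/eqP; rewrite eq_le box_volume_ge0 andbT.
by apply: ereal_inf_lbound; left.
Qed.

Let lebesgue_outerE : lebesgue_outer = @mu_ext _ discr R box_volume.
Proof.
apply/funext => X; rewrite /lebesgue_outer /mu_ext; congr ereal_inf.
apply/seteqP; split=> [_ [F XF <-]|_ [F [_ XF] <-]]; exists F => //.
by split=> // i; exact: sub_sigma_algebra.
Qed.

Let lebesgue_outer0 : lebesgue_outer set0 = 0.
Proof. by rewrite lebesgue_outerE; exact: mu_ext0. Qed.

Let lebesgue_outer_ge0 X : 0 <= lebesgue_outer X.
Proof. by rewrite lebesgue_outerE; exact: mu_ext_ge0. Qed.

Let le_lebesgue_outer : {homo lebesgue_outer : A B / A `<=` B >-> A <= B}.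
Proof. by rewrite lebesgue_outerE; exact: (@le_mu_ext _ discr R box_volume). Qed.

Let lebesgue_outer_sigma_subadditive : sigma_subadditive lebesgue_outer.
Proof.
rewrite lebesgue_outerE.
exact: (@mu_ext_sigma_subadditive _ discr R box_volume box_volume_ge0).
Qed.

HB.instance Definition _ := isOuterMeasure.Build R 'rV[R]_n lebesgue_outer
  lebesgue_outer0 lebesgue_outer_ge0 le_lebesgue_outer
  lebesgue_outer_sigma_subadditive.

Definition lebesgue_measurable : set (set 'rV[R]_n) :=
  lebesgue_outer.-caratheodory.

(* For a Lebesgue measurable D, the Caratheodory measurable sets of this outer
   measure are the sets A such that A `&` D is Lebesgue measurable: the measure
   it induces is the Lebesgue measure on D, carried by the ambient space. *)
Definition lebesgue_outer_on D X : \bar R := lebesgue_outer (X `&` D).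

Variable D : set 'rV[R]_n.

Let outer_on0 : lebesgue_outer_on D set0 = 0.
Proof. by rewrite /lebesgue_outer_on set0I. Qed.

Let outer_on_ge0 X : 0 <= lebesgue_outer_on D X.
Proof. exact: lebesgue_outer_ge0. Qed.

Let le_outer_on : {homo lebesgue_outer_on D : A B / A `<=` B >-> A <= B}.
Proof. by move=> A B AB; apply: le_lebesgue_outer; exact: setSI. Qed.

Let outer_on_sigma_subadditive : sigma_subadditive (lebesgue_outer_on D).
Proof.
move=> F; rewrite /lebesgue_outer_on setI_bigcupl.
exact: lebesgue_outer_sigma_subadditive.
Qed.

HB.instance Definition _ := isOuterMeasure.Build R 'rV[R]_n
  (lebesgue_outer_on D) outer_on0 outer_on_ge0 le_outer_on
  outer_on_sigma_subadditive.

Definition lebesgue_on :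
    {measure set (caratheodory_type (lebesgue_outer_on D)) -> \bar R} :=
  caratheodory_measure_of (lebesgue_outer_on D).

Lemma lebesgue_onE A : lebesgue_on A = lebesgue_outer (A `&` D).
Proof. by []. Qed.

End LebesgueRn.

Section LipschitzDomain.
Context {R : realType} {d : nat}.
Implicit Types x y e : 'rV[R]_d.

Definition dotp x y : R := \sum_(i < d) x ord0 i * y ord0 i.

(* y - dotp y e *: e is the orthogonal projection of y on the hyperplane
   normal to e: near each boundary point, Om lies strictly above the graph,
   in the direction of the unit vector e, of a Lipschitz function of the
   coordinates orthogonal to e. *)
Definition bounded_lipschitz_domain (Om : set 'rV[R]_d) : Prop :=
  [/\ open Om, connected Om, Om !=set0, bounded_set Om &
    forall x, (closure Om `\` Om) x ->
      exists e (g : 'rV[R]_d -> R),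
        [/\ dotp e e = 1, [lipschitz g y | y in setT] &
          \forall y \near x, Om y <-> g (y - dotp y e *: e) < dotp y e]].

End LipschitzDomain.

Lemma lee1_ltW (R : realType) (p : R) : 1 < p -> (1 <= p%:E)%E.
Proof. by move=> p1; rewrite lee_fin ltW. Qed.

Definition Lp {R : realType} {n : nat} (D : set 'rV[R]_n) {p : R} (p1 : 1 < p) :=
  LspaceType (lebesgue_on D) (lee1_ltW p1).

Definition L1 {d} {T : measurableType d} {R : realType}
    (mu : {measure set T -> \bar R}) := LspaceType mu (lexx 1%E).

Section BoundedLinear.
Context {R : realType}.

Section Norm.
Context {d} {T : measurableType d} {mu : {measure set T -> \bar R}} {p : \bar R}
  {p1 : (1 <= p)%E}.

Definition Lpnorm (u : LspaceType mu p1) : \bar R :=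
  'N[mu]_p [EFin \o (u : T -> R)]%E.

(* w = a u + v in the Lebesgue space: an element of LspaceType is a class of
   functions modulo a.e. equality, coerced to one of its representatives. *)
Definition is_lincomb (a : R) (u v w : LspaceType mu p1) : Prop :=
  (w : T -> R) = (fun x => a * (u : T -> R) x + (v : T -> R) x) %[ae mu].

End Norm.

Definition bounded_linear_op {d1 d2} {T1 : measurableType d1}
    {T2 : measurableType d2} {mu : {measure set T1 -> \bar R}}
    {nu : {measure set T2 -> \bar R}} {p q : \bar R} {p1 : (1 <= p)%E}
    {q1 : (1 <= q)%E} (A : LspaceType mu p1 -> LspaceType nu q1) : Prop :=
  (forall a u v w, is_lincomb a u v w -> is_lincomb a (A u) (A v) (A w)) /\
  exists C : R, forall u, (Lpnorm (A u) <= C%:E * Lpnorm u)%E.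

Section WeakConvergence.
Context {d} {T : measurableType d} {mu : {measure set T -> \bar R}} {p : \bar R}
  {p1 : (1 <= p)%E} {N : nat}.
Let V := 'I_N -> LspaceType mu p1.

Definition bounded_linear_form (l : V -> R) : Prop :=
  (forall a u v w, (forall i, is_lincomb a (u i) (v i) (w i)) ->
     l w = a * l u + l v) /\
  exists C : R, forall u,
    ((`|l u|)%:E <= C%:E * \sum_(i < N) Lpnorm (u i))%E.

Definition weak_cvg (u : nat -> V) (u0 : V) : Prop :=
  forall l, bounded_linear_form l -> l (u n) @[n --> \oo] --> l u0.

Definition weakly_lsc (F : V -> \bar R) : Prop :=
  forall u u0, weak_cvg u u0 -> (F u0 <= limn_einf (F \o u))%E.

End WeakConvergence.
End BoundedLinear.

Definition subsequence (phi : nat -> nat) : Prop :=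
  {homo phi : m n / (m < n)%N}.

Section Discrepancies.
Context {R : realType} {d} {T : measurableType d}
  (mu : {measure set T -> \bar R}).
Local Open Scope ereal_scope.
Implicit Types v f : T -> R.

Definition norm1 v : \bar R := 'N[mu]_1 [EFin \o v].

(* The integral is extended-real valued: norm2 v is the L^2 norm of v if v is
   square integrable and +oo otherwise. For v in L^p(D), with D bounded and
   measurable, this is the supremum of the integrals of v * phi over the smooth
   compactly supported phi : R^m -> R with L^2(D) norm at most 1. Requiring in
   addition that the support of phi lie in D would give 0 when D has empty
   interior. *)
Definition norm2 v : \bar R := 'N[mu]_2%:E [EFin \o v].

(* b log (a / b), with the conventions 0 log (a / 0) = 0 for 0 <= a and
   b log (0 / b) = -oo for 0 < b. *)
Definition mul_log_div (a b : R) : \bar R :=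
  if b == 0%R then 0 else if a == 0%R then -oo else (b * ln (a / b))%R%:E.

Definition ae_ge0 v : Prop := {ae mu, forall x, (0 <= v x)%R}.

Definition KL v f : \bar R :=
  if `[< ae_ge0 v /\ ae_ge0 f >] then
    \int[mu]_x ((v x)%:E - (f x)%:E - mul_log_div (v x) (f x))
  else +oo.

End Discrepancies.

Definition is_minimizer {R : realType} {V : Type} (F : V -> \bar R) (u : V) :=
  forall v, (F u <= F v)%E.

Definition proper_functional {R : realType} {V : Type} (F : V -> \bar R) : Prop :=
  exists u, (F u < +oo)%E.

Definition idx {N : nat} (L : {set 'I_N}) : Type := {i : 'I_N | i \in L}.
HB.instance Definition _ N (L : {set 'I_N}) := Finite.on (idx L).

Unset Implicit Arguments.

(* For i in Lkl, B i is meant to be a sigma-algebra on the set S i. The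
   measurable sets of g_sigma_algebraType (B i) are then the elements of B i and
   their complements in the ambient space, so that the finite measure spaces on
   (S i, B i) are the finite measures mu i that vanish on ~` S i. *)
Section Functional.
Context {R : realType} {N : nat} {Lnr Lkl : {set 'I_N}} {d : nat}
  {Om : set 'rV[R]_d} {p : R} {p1 : 1 < p} {m : 'I_N -> nat}
  {S : forall i, set 'rV[R]_(m i)}
  {B : forall i : idx Lkl, set (set 'rV[R]_(m (sval i)))}
  {mu : forall i : idx Lkl,
    {finite_measure set (g_sigma_algebraType (B i)) -> \bar R}}.
Local Open Scope ereal_scope.

Definition data_space : Type :=
  (forall i : idx Lnr, Lp (S (sval i)) p1) * (forall i : idx Lkl, L1 (mu i)).

Variables (Reg : ('I_N -> Lp Om p1) -> \bar R)
  (Tnr : forall i : idx Lnr, Lp Om p1 -> Lp (S (sval i)) p1)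
  (Tkl : forall i : idx Lkl, Lp Om p1 -> L1 (mu i))
  (c : forall i : idx Lkl, L1 (mu i)).

Definition nr_term (i : idx Lnr) (u : 'I_N -> Lp Om p1) (f : data_space)
    : \bar R :=
  norm2 (lebesgue_on (S (sval i)))
    (fun x => Tnr i (u (sval i)) x - f.1 i x)%R ^+ 2.

Definition kl_term (i : idx Lkl) (u : 'I_N -> Lp Om p1) (f : data_space)
    : \bar R :=
  KL (mu i) (fun x => Tkl i (u (sval i)) x + c i x)%R (f.2 i).

Definition J (lambda : 'I_N -> R) (f : data_space) (u : 'I_N -> Lp Om p1)
    : \bar R :=
  Reg u + \sum_(i : idx Lnr) (lambda (sval i))%:E * nr_term i u f
        + \sum_(i : idx Lkl) (lambda (sval i))%:E * kl_term i u f.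

Definition assumption_NKL : Prop :=
  [/\ weakly_lsc Reg,
      (forall i, bounded_linear_op (Tnr i)) /\
      (forall i, bounded_linear_op (Tkl i)) &
      forall (C : R) (u : nat -> 'I_N -> Lp Om p1), (0 < C)%R ->
        (forall n, Reg (u n) + \sum_(i : idx Lnr) Lpnorm (Tnr i (u n (sval i)))
          + \sum_(i : idx Lkl) Lpnorm (Tkl i (u n (sval i))) < C%:E) ->
        exists phi u0, subsequence phi /\ weak_cvg (u \o phi) u0].

End Functional.

(* Main.v *)
Require Import Defs.
From mathcomp Require Import all_boot all_order all_algebra.
From mathcomp Require Import all_classical all_reals all_analysis.
From mathcomp Require Import measurable_realfun ring lra.
Import Order.TTheory GRing.Theory Num.Def Num.Theory.
Import numFieldNormedType.Exports.
Local Open Scope classical_set_scope.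
Local Open Scope ring_scope.

(** The proof is the direct method, carried by one observation: every
    discrepancy is a supremum of functionals that are affine, with bounded
    coefficients, in the operator value and the datum. For nonnegative a and b,
      a - b - b log (a / b) = sup over r > 0 of (1 - r) a + b log r,
    and a ^ 2 is the supremum over r of 2 r a - r ^ 2. Replacing r by a bounded
    measurable function of the point gives quantities that pass to the limit
    under convergence tested against bounded functions, and suitable choices of
    r exhaust the integral by Fatou's lemma. Hence both discrepancies are lower
    semicontinuous jointly in the operator value and the datum ([KL_lsc],
    [norm2_lsc]). A bounded operator composed with the integral against a
    bounded function is a bounded linear form, so weak convergence of u in L^p
    yields exactly that convergence for T u ([weak_cvg_op]).

    Existence. The choice r = 1/2 gives the bound of |v|_1 by
    2 KL(v, f) + 2 log 2 |f|_1 ([norm1_le_KL]), and on a space of finite measure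
    the L^p norm is controlled by the L^2 norm as p <= 2. Sublevel sets of J,
    uniformly in data close to a fixed one, therefore lie in the sets that
    Assumption (NKL) declares weakly sequentially compact ([coercive]), and a
    minimizing sequence has a subsequence converging to a minimizer.

    Stability. When b1 f <= v <= b0 f the logarithm of v / f is bounded, and
      KL(v, f^n) = KL(f, f^n) + integral of v - f - f^n log (v / f),
    so that KL(v, f^n) converges to KL(v, f) ([cvg_KL]). Thus J(u0, f^n) has
    an upper bound converging to J(u0, fd) ([recovery]): the minimal values stay
    bounded, which makes the minimizers compact, and lower semicontinuity makes
    every weak limit a minimizer. At the limit v all summands of J are lower
    semicontinuous along the sequence while their sum is asymptotically at most
    J(v, fd) < oo, so none of them can lose mass and each one converges
    ([cvg_summand]). *)

(** * Lower limits of extended real sequences *)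

Section LowerLimits.
#[local] Set Implicit Arguments.
#[local] Unset Strict Implicit.
Context {R : realType}.
Local Open Scope ereal_scope.
Implicit Types (u v : (\bar R)^nat) (l : \bar R).

Lemma lee_of_real_below l l' :
  (forall a : R, a%:E < l -> a%:E <= l') -> l <= l'.
Proof.
case: l => [r| |] h; last by rewrite leNye.
- apply/lee_addgt0Pr => e e0.
  have := h (r - e)%R; rewrite lte_fin ltrBlDr ltrDl => /(_ e0).
  by rewrite EFinB leeBlDr.
- case: l' h => [r| |] h; last 2 first.
  + by rewrite lexx.
  + by have := h 0%R; rewrite ltry => /(_ isT).
  + by have := h (r + 1)%R; rewrite ltry lee_fin gerDl ler10 => /(_ isT).
Qed.

(** Lower bounds for lower limits are handled through this characterization, in
    which sums, scalings and comparisons are eventual statements about reals. *)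
Lemma le_limn_einfP u l :
  l <= limn_einf u <-> forall a : R, a%:E < l -> \forall n \near \oo, a%:E < u n.
Proof.
have E : limn_einf u = ereal_sup (range (einfs u)).
  by rewrite limn_einf_lim; apply/cvg_lim => //; exact: cvg_einfs_sup.
rewrite E; split=> [lu a al|h].
  have /ereal_sup_gt[_ [n _ <-] an] := lt_le_trans al lu.
  exists n => // k /= nk; apply: (lt_le_trans an); apply: ereal_inf_lbound.
  by exists k.
apply: lee_of_real_below => a /h [n _ an].
apply: le_trans (ereal_sup_ubound _); last by exists n.
by apply: le_ereal_inf_tmp => _ [k /= nk <-]; apply/ltW/an.
Qed.

Lemma limn_einf_ge_cvg u v l :
  l <= limn_einf u -> (\forall n \near \oo, u n <= v n) ->
  l <= limn_einf v.
Proof.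
move=> /le_limn_einfP h uv; apply/le_limn_einfP => a /h ha.
near=> n; apply: (lt_le_trans (y := u n)); near: n; first exact: ha.
exact: uv.
Unshelve. all: by end_near. Qed.

Lemma le_limn_einf_cvg u v l l' : l <= limn_einf u ->
  (\forall n \near \oo, u n <= v n) -> v n @[n --> \oo] --> l' -> l <= l'.
Proof.
move=> lu uv vl; have := limn_einf_ge_cvg lu uv.
by rewrite (cvg_limn_einf_sup vl).1.
Qed.

(** Nonnegativity excludes the indeterminate form, including when one of the
    lower bounds is infinite. *)
Lemma limn_einf_geD u v l l' : (forall n, 0 <= u n) -> (forall n, 0 <= v n) ->
  l <= limn_einf u -> l' <= limn_einf v -> l + l' <= limn_einf (u \+ v).
Proof.
move=> u0 v0 /le_limn_einfP hu /le_limn_einfP hv; apply/le_limn_einfP => a.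
case: l hu => [r| |] hu; last by [].
- case: l' hv => [s| |] hv; last by [].
  + rewrite -EFinD lte_fin => ars; pose e := ((r + s - a) / 2)%R.
    have e0 : (0 < e)%R by rewrite divr_gt0// subr_gt0.
    have ea : a = (r - e + (s - e))%R by rewrite /e; field.
    have h1 := hu (r - e)%R; have h2 := hv (s - e)%R.
    rewrite lte_fin gtrBl e0 in h1; rewrite lte_fin gtrBl e0 in h2.
    have {}h1 := h1 isT; have {}h2 := h2 isT.
    near=> n; rewrite /= ea EFinD lteD//; near: n; [exact: h1|exact: h2].
  + move=> _; have h := hv a; rewrite ltry in h; have {}h := h isT.
    near=> n; apply: (lt_le_trans (y := v n)); first by near: n.
    by rewrite leeDr.
- move=> _; have h := hu a; rewrite ltry in h; have {}h := h isT.
  near=> n; apply: (lt_le_trans (y := u n)); first by near: n.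
  by rewrite leeDl.
Unshelve. all: by end_near. Qed.

Lemma limn_einf_geZ u l (k : R) : (0 < k)%R -> l <= limn_einf u ->
  k%:E * l <= limn_einf (fun n => k%:E * u n).
Proof.
move=> k0 /le_limn_einfP h; apply/le_limn_einfP => a.
rewrite -lte_pdivrMl// -EFinM => /h ha; near=> n.
by rewrite -lte_pdivrMl// -EFinM; near: n.
Unshelve. all: by end_near. Qed.

Lemma limn_einf_ge_sum (I : finType) (P : pred I) (u : I -> (\bar R)^nat)
    (l : I -> \bar R) :
  (forall i n, 0 <= u i n) -> (forall i, l i <= limn_einf (u i)) ->
  \sum_(i | P i) l i <= limn_einf (fun n => \sum_(i | P i) u i n).
Proof.
move=> u0 ul; elim: (index_enum I) => [|i r ih].
  have -> : (fun n => \sum_(i <- [::] | P i) u i n) = cst 0.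
    by apply/funext => n; rewrite big_nil.
  by rewrite big_nil (cvg_limn_einf_sup (cvg_cst _)).1.
under [X in limn_einf X]eq_fun do rewrite big_cons.
rewrite big_cons; case: (P i) => //.
by apply: limn_einf_geD => // n; apply: sume_ge0.
Qed.

(** Each summand is bounded below by its own lower limit, and above by L minus
    the lower limit of the other one; the two bounds meet since L tends to the
    finite number l + l'. *)
Lemma cvg_summand u v l l' L : (forall n, 0 <= u n) -> (forall n, 0 <= v n) ->
  0 <= l -> 0 <= l' -> l + l' < +oo ->
  l <= limn_einf u -> l' <= limn_einf v ->
  (\forall n \near \oo, u n + v n <= L n) -> L n @[n --> \oo] --> l + l' ->
  u n @[n --> \oo] --> l.
Proof.
move=> u0 v0 l0 l'0; case: l l0 => [r| |]// r0; case: l' l'0 => [s| |]// s0 _.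
move=> /le_limn_einfP hu /le_limn_einfP hv uvL.
rewrite -EFinD => /fine_cvgP[Lfin Lrs].
have key (e : R) : (0 < e)%R -> \forall n \near \oo,
    (u n \is a fin_num) /\ (`|r - fine (u n)| < e)%R.
  move=> e0.
  have e20 : (0 < e / 2)%R by rewrite divr_gt0.
  have {}hu := hu (r - e)%R; rewrite lte_fin gtrBl e0 in hu; have {}hu := hu isT.
  have {}hv := hv (s - e / 2)%R; rewrite lte_fin gtrBl e20 in hv; have {}hv := hv isT.
  have /cvgrPdist_lt/(_ _ e20) hL := Lrs.
  near=> n.
  have : (u n + v n <= L n) by near: n.
  have : ((r - e)%:E < u n) by near: n.
  have : ((s - e / 2)%:E < v n) by near: n.
  have : L n \is a fin_num by near: n.
  have : (`|r + s - fine (L n)| < e / 2)%R by near: n; exact: hL.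
  move: (u0 n) (v0 n).
  case: (u n) => [x| |]//; case: (v n) => [y| |]//; case: (L n) => [z| |]//=.
  rewrite -EFinD !lte_fin !lee_fin => _ _ h1 _ h2 h3 h4; split=> //.
  move: h1; rewrite !ltr_norml => /andP[h1 h1']; apply/andP; split; lra.
apply: (iffRL (fine_cvgP _ _)); split.
  by have := key _ ltr01; apply: filterS => n [].
apply/cvgrPdist_lt => e /key; apply: filterS => n [] //.
Unshelve. all: by end_near. Qed.

Lemma cvg_summands (I : finType) (u : I -> (\bar R)^nat) (l : I -> \bar R) :
  (forall i n, 0 <= u i n) -> (forall i, 0 <= l i) -> \sum_i l i < +oo ->
  (forall i, l i <= limn_einf (u i)) ->
  \sum_i u i n @[n --> \oo] --> \sum_i l i -> forall i, u i n @[n --> \oo] --> l i.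
Proof.
move=> u0 l0 lfin lu + i; rewrite (bigD1 i)//=.
under eq_fun do rewrite (bigD1 i)//=.
rewrite (bigD1 i)//= in lfin => h.
apply: (@cvg_summand _ (fun n => \sum_(j | j != i) u j n) _ _ _ _ _ _ _ lfin
  (lu i) _ _ h).
- exact: u0.
- by move=> n; apply: sume_ge0.
- exact: l0.
- by apply: sume_ge0.
- exact: limn_einf_ge_sum.
- by apply: nearW => n.
Qed.

Lemma subsequence_ge (phi : nat -> nat) n : subsequence phi -> (n <= phi n)%N.
Proof.
move=> hphi; elim: n => // n ih; apply: leq_ltn_trans ih _; exact: hphi.
Qed.

Lemma cvg_subsequence (phi : nat -> nat) :
  subsequence phi -> phi n @[n --> \oo] --> \oo.
Proof.
move=> hphi; apply/cvgnyPge => A; exists A => // n /= An.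
exact: leq_trans An (subsequence_ge n hphi).
Qed.

End LowerLimits.

(** * The Kullback-Leibler integrand as a supremum of affine functions *)

Section KLDensity.
#[local] Set Implicit Arguments.
#[local] Unset Strict Implicit.
Context {R : realType}.
Implicit Types a b r : R.

Definition kl_density a b : \bar R := (a%:E - b%:E - mul_log_div a b)%E.

(** For r > 0 these are the affine minorants of the integrand. *)
Definition kl_affine r a b : R := (1 - r) * a + ln r * b.

(** For positive a and b this is log x <= x - 1 at x = r a / b. *)
Lemma kl_affine_le r a b : 0 < r -> 0 <= a -> 0 <= b ->
  ((kl_affine r a b)%:E <= kl_density a b)%E.
Proof.
move=> r0 a0 b0; rewrite /kl_density /mul_log_div /kl_affine.
have [->|bn] := eqVneq b 0.
  rewrite mulr0 addr0 !sube0 lee_fin ler_piMl// gerBl; exact: ltW.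
have [->|an] := eqVneq a 0; first by rewrite addey// leey.
have {an}a0 : 0 < a by rewrite lt_neqAle eq_sym an.
have {bn}b0 : 0 < b by rewrite lt_neqAle eq_sym bn.
rewrite -!EFinB lee_fin.
have : ln (r * (a / b)) <= r * (a / b) - 1.
  have e : r * (a / b) = 1 + (r * (a / b) - 1) by ring.
  rewrite {1}e le_ln1Dx// ltrBrDr addNr.
  by rewrite mulr_gt0 ?divr_gt0.
rewrite lnM ?posrE ?divr_gt0// => /(ler_wpM2l (ltW b0)).
have -> : b * (r * (a / b) - 1) = r * a - b by field; rewrite gt_eqF.
move=> h; lra.
Qed.

Lemma kl_affine1 a b : kl_affine 1 a b = 0.
Proof. by rewrite /kl_affine ln1 subrr !mul0r addr0. Qed.

Lemma kl_density_ge0 a b : 0 <= a -> 0 <= b -> (0 <= kl_density a b)%E.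
Proof.
move=> a0 b0; apply: le_trans (kl_affine_le ltr01 a0 b0).
by rewrite kl_affine1.
Qed.

(** The maximizer of r |-> kl_affine r a b is b / a, read as 0 for b = 0 and as
    oo for a = 0. It is kept when it lies between 1/(k+1) and k+1; otherwise
    it is replaced by a value in that range, for which the affine minorant is
    still nonnegative. Writing b / a through exp and ln makes its logarithm
    explicit. *)
Definition kl_slope k a b : R :=
  if b == 0 then k.+1%:R^-1 else if a == 0 then k.+1%:R else
  let r := expR (ln b - ln a) in
  if (k.+1%:R^-1 <= r) && (r <= k.+1%:R) then r else 1.

Lemma kl_slope_bounded k a b : k.+1%:R^-1 <= kl_slope k a b <= k.+1%:R.
Proof.
have k1 : (1 : R) <= k.+1%:R by rewrite ler1n.
have k0 : (0 : R) < k.+1%:R by rewrite ltr0n.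
have kV : k.+1%:R^-1 <= (1 : R) by rewrite invf_le1.
rewrite /kl_slope; case: ifP => _; first by rewrite lexx (le_trans kV).
case: ifP => _; first by rewrite lexx (le_trans kV).
by case: ifP => // _; rewrite kV.
Qed.

Lemma kl_affine_opt a b : 0 < a -> 0 < b ->
  (kl_affine (expR (ln b - ln a)) a b)%:E = kl_density a b.
Proof.
move=> a0 b0; rewrite /kl_density /mul_log_div !gt_eqF// /kl_affine -!EFinB.
rewrite expRK expRD expRN !lnK ?posrE// ln_div ?posrE//.
by congr EFin; field; rewrite gt_eqF.
Qed.

Lemma kl_affine_slope_ge0 k a b : 0 <= a -> 0 <= b ->
  0 <= kl_affine (kl_slope k a b) a b.
Proof.
move=> a0 b0.
have k1 : (1 : R) <= k.+1%:R by rewrite ler1n.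
have [b00|bn] := eqVneq b 0.
  rewrite /kl_slope b00 eqxx /kl_affine mulr0 addr0 mulr_ge0// subr_ge0.
  by rewrite invf_le1// ltr0n.
have [a00|an] := eqVneq a 0.
  rewrite /kl_slope (negbTE bn) a00 eqxx /kl_affine mulr0 add0r.
  by rewrite mulr_ge0// ln_ge0.
rewrite /kl_slope (negbTE bn) (negbTE an) /=.
case: ifP => _; last by rewrite kl_affine1.
rewrite -lee_fin kl_affine_opt ?kl_density_ge0//.
- by rewrite lt_neqAle eq_sym an.
- by rewrite lt_neqAle eq_sym bn.
Qed.

Lemma cvg_kl_affine_slope a b : 0 <= a -> 0 <= b ->
  (kl_affine (kl_slope k a b) a b)%:E @[k --> \oo] --> kl_density a b.
Proof.
move=> a0 b0.
have kV : (k.+1%:R^-1 : R) @[k --> \oo] --> (0 : R) by exact: cvg_harmonic.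
have [->|bn] := eqVneq b 0.
  rewrite /kl_slope eqxx /kl_density /mul_log_div eqxx !sube0.
  apply: cvg_EFin; first exact: nearW.
  rewrite (_ : _ \o _ = fun k => (1 - k.+1%:R^-1) * a); last first.
    by apply/funext => k /=; rewrite /kl_affine mulr0 addr0.
  rewrite -[X in _ --> X]mul1r -[X in X * _]subr0.
  by apply: cvgMl; apply: cvgB => //; exact: cvg_cst.
have {}b0 : 0 < b by rewrite lt_neqAle eq_sym bn.
have [->|an] := eqVneq a 0.
  rewrite /kl_slope (negbTE bn) eqxx /kl_density /mul_log_div eqxx (negbTE bn).
  rewrite /= addey//; apply/cvgeyPge => A.
  near=> k; rewrite lee_fin /kl_affine mulr0 add0r -ler_pdivrMr//.
  rewrite -(expRK (A / b)) ler_ln ?posrE ?expR_gt0//.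
  rewrite (@le_trans _ _ k%:R)// ?ler_nat//; near: k.
  exact: nbhs_infty_ger.
have {}a0 : 0 < a by rewrite lt_neqAle eq_sym an.
rewrite -kl_affine_opt//; apply: cvg_near_cst.
have r0 : 0 < expR (ln b - ln a) :> R by exact: expR_gt0.
near=> k; rewrite /kl_slope (negbTE bn) (negbTE an) /= ifT//; apply/andP; split.
  by apply/ltW; near: k; exact: (near_infty_natSinv_lt (PosNum r0)).
rewrite (@le_trans _ _ k%:R)// ?ler_nat//; near: k.
exact: nbhs_infty_ger.
Unshelve. all: by end_near. Qed.

End KLDensity.

(** * Measurability of the integrand *)

Section Measurability.
#[local] Set Implicit Arguments.
#[local] Unset Strict Implicit.
Context {d} {T : measurableType d} {R : realType}.
Implicit Types v f : T -> R.

(** The inverse is discontinuous at 0 only; on each side of 0 it is a power. *)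
Lemma measurable_funV v : measurable_fun setT v ->
  measurable_fun setT (fun x => (v x)^-1).
Proof.
move=> mv; have -> : (fun x => (v x)^-1) = (fun x =>
    if 0 < v x then v x `^ (-1) else if v x < 0 then - ((- v x) `^ (-1)) else 0).
  apply/funext => x; case: ltgtP => [x0|x0|<-]; last by rewrite invr0.
    by rewrite powR_inv1// ltW.
  by rewrite powR_inv1 ?oppr_ge0 ?ltW// invrN opprK.
have mp (w : T -> R) : measurable_fun setT w ->
    measurable_fun setT (fun x => w x `^ (-1)).
  by move=> mw; exact: (measurableT_comp (@measurable_powR R (-1)) mw).
apply: measurable_fun_ifT.
- exact: measurable_fun_ltr.
- exact: mp.
- apply: measurable_fun_ifT => //; first exact: measurable_fun_ltr.
  by apply: measurableT_comp => //; apply: mp; exact: measurableT_comp.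
Qed.

Lemma measurable_kl_density v f : measurable_fun setT v -> measurable_fun setT f ->
  measurable_fun setT (fun x => kl_density (v x) (f x)).
Proof.
move=> mv mf; apply: emeasurable_funB.
  by apply: emeasurable_funB; exact/measurable_EFinP.
rewrite /mul_log_div; apply: measurable_fun_ifT => //.
  exact: measurable_fun_eqr.
apply: measurable_fun_ifT => //; first exact: measurable_fun_eqr.
apply/measurable_EFinP; apply: measurable_funM => //.
apply: (measurableT_comp (@measurable_ln R)); apply: measurable_funM => //.
exact: measurable_funV.
Qed.

Lemma measurable_kl_slope k v f : measurable_fun setT v -> measurable_fun setT f ->
  measurable_fun setT (fun x => kl_slope k (v x) (f x)).
Proof.
move=> mv mf; have mr : measurable_fun setT (fun x => expR (ln (f x) - ln (v x))).
  apply: (measurableT_comp (@measurable_expR R)).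
  by apply: measurable_funB; exact: (measurableT_comp (@measurable_ln R)).
rewrite /kl_slope; apply: measurable_fun_ifT => //; first exact: measurable_fun_eqr.
apply: measurable_fun_ifT => //; first exact: measurable_fun_eqr.
apply: measurable_fun_ifT => //; apply: measurable_and; exact: measurable_fun_ler.
Qed.

End Measurability.

(** * Convergence against bounded functions and lower semicontinuity of KL *)

Section WeakL1.
#[local] Set Implicit Arguments.
#[local] Unset Strict Implicit.
Context {d} {T : measurableType d} {R : realType}.
Variable mu : {measure set T -> \bar R}.
Hypothesis muT : (mu setT < +oo)%E.
Implicit Types (v f r phi : T -> R).

Definition integrableR v := mu.-integrable setT (EFin \o v).

Definition bounded_mfun phi :=
  measurable_fun setT phi /\ exists M, forall x, `|phi x| <= M.

(** Boundedness of the test functions makes sense of this for integrable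
    functions, whatever the exponent of the space in which the sequence
    converges weakly. *)
Definition weak_L1_cvg (vn : nat -> T -> R) v := forall phi, bounded_mfun phi ->
  \int[mu]_x (vn n x * phi x) @[n --> \oo] --> \int[mu]_x (v x * phi x).

Lemma integrableR_measurable v : integrableR v -> measurable_fun setT v.
Proof. by move=> /(measurable_int mu)/measurable_EFinP. Qed.

Lemma bounded_mfun_bounded phi : bounded_mfun phi -> [bounded phi x | x in setT].
Proof.
move=> [_ [M hM]]; exists M; split; first exact: num_real.
by move=> e Me x _; apply: le_trans (hM x) (ltW Me).
Qed.

Lemma integrableR_mul v phi : integrableR v -> bounded_mfun phi ->
  integrableR (fun x => v x * phi x).
Proof.
move=> iv bphi; have := integrableMl measurableT iv bphi.1 (bounded_mfun_bounded bphi).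
by apply: eq_integrable => // x _.
Qed.

Lemma integrableR_D v f : integrableR v -> integrableR f ->
  integrableR (fun x => v x + f x).
Proof.
by move=> iv jf; have := integrableD measurableT iv jf; apply: eq_integrable.
Qed.

Lemma integrableR_B v f : integrableR v -> integrableR f ->
  integrableR (fun x => v x - f x).
Proof.
by move=> iv jf; have := integrableB measurableT iv jf; apply: eq_integrable.
Qed.

Lemma integrableR_Z (a : R) v : integrableR v -> integrableR (fun x => a * v x).
Proof.
by move=> iv; have := integrableZl measurableT a iv; apply: eq_integrable.
Qed.

Lemma integrableR_norm v : integrableR v -> integrableR (fun x => `|v x|).
Proof. exact: integrable_norm. Qed.

Lemma bounded_integrableR phi : bounded_mfun phi -> integrableR phi.
Proof.
move=> bphi; apply: measurable_bounded_integrable => //.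
- exact: bphi.1.
- exact: bounded_mfun_bounded.
Qed.

Lemma Rintegral_ae_eq v f : measurable_fun setT v -> measurable_fun setT f ->
  {ae mu, forall x, v x = f x} -> \int[mu]_x v x = \int[mu]_x f x.
Proof.
move=> mv mf vf; congr fine; apply: ae_eq_integral => //; try exact/measurable_EFinP.
by apply: filterS vf => x -> .
Qed.

(** The form in which suprema of weakly continuous functionals are used: the
    minorants need not be monotone in k, Fatou's lemma suffices. *)
Lemma limn_einf_ge_integral (G : (\bar R)^nat) (h : nat -> T -> \bar R) g :
  (forall k, measurable_fun setT (h k)) -> (forall k x, 0 <= h k x)%E ->
  (forall x, h k x @[k --> \oo] --> g x) ->
  (forall k, \int[mu]_x h k x <= limn_einf G)%E ->
  (\int[mu]_x g x <= limn_einf G)%E.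
Proof.
move=> mh h0 hg hG.
have -> : (\int[mu]_x g x = \int[mu]_x limn_einf (h ^~ x))%E.
  by apply: eq_integral => x _; rewrite (cvg_limn_einf_sup (hg x)).1.
apply: le_trans (fatou mu measurableT mh _) _ => //.
apply: lee_of_real_below => a ha.
have /le_limn_einfP/(_ _ ha)[k _ hk] :=
  lexx (limn_einf (fun n => (\int[mu]_x h n x)%E)).
by apply: ltW; apply: (lt_le_trans (hk k (leqnn k))).
Qed.

Lemma limn_einf_ge_real (G : (\bar R)^nat) (s : nat -> R) (l : R) :
  s n @[n --> \oo] --> l -> (forall n, (s n)%:E <= G n)%E -> (l%:E <= limn_einf G)%E.
Proof.
move=> sl sG; have : (s n)%:E @[n --> \oo] --> l%:E.
  by apply: cvg_EFin => //; exact: nearW.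
move=> /cvg_limn_einf_sup[<- _].
apply: (limn_einf_ge_cvg (lexx _)); exact: nearW.
Qed.

(** The formula that defines the divergence is meaningful at nonnegative
    arguments only. Truncating at 0 changes neither function up to a negligible
    set, and makes the integrand nonnegative everywhere. *)
Lemma KLE v f : integrableR v -> integrableR f -> ae_ge0 mu v -> ae_ge0 mu f ->
  KL mu v f = (\int[mu]_x kl_density (maxr (v x) 0%R) (maxr (f x) 0%R))%E.
Proof.
move=> /integrableR_measurable mv /integrableR_measurable mf v0 f0.
rewrite /KL asboolT//; apply: ae_eq_integral => //.
- exact: measurable_kl_density.
- by apply: measurable_kl_density; apply: measurable_maxr.
- move: v0 f0; apply: filterS2 => x v0 f0 _.
  by rewrite !max_l.
Qed.

(** The admissible multipliers: both 1 - r and ln \o r are then bounded. *)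
Definition slope_fun (k : nat) r :=
  measurable_fun setT r /\ forall x, k.+1%:R^-1 <= r x <= k.+1%:R.

Lemma slope_fun_gt0 k r x : slope_fun k r -> 0 < r x.
Proof.
move=> [_ /(_ x)/andP[+ _]]; apply: lt_le_trans; by rewrite invr_gt0 ltr0n.
Qed.

Lemma slope_fun_bounded k r : slope_fun k r ->
  bounded_mfun (fun x => 1 - r x) /\ bounded_mfun (fun x => ln (r x)).
Proof.
move=> kr; have r0 x := slope_fun_gt0 x kr; case: kr => mr kr; split; split.
- exact: measurable_funB.
- exists (1 + k.+1%:R) => x; rewrite (le_trans (ler_normB _ _))// normr1 lerD2l.
  by rewrite gtr0_norm//; have /andP[] := kr x.
- exact: (measurableT_comp (@measurable_ln R)).
- exists (ln k.+1%:R) => x; rewrite ler_norml -lnV ?posrE//.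
  by rewrite !ler_ln ?posrE ?invr_gt0.
Qed.

Lemma integrableR_kl_affine k r v f : slope_fun k r -> integrableR v -> integrableR f ->
  integrableR (fun x => kl_affine (r x) (v x) (f x)).
Proof.
move=> /slope_fun_bounded[b1 b2] iv jf.
have := integrableD measurableT (integrableR_mul iv b1) (integrableR_mul jf b2).
by apply: eq_integrable => // x _; rewrite /kl_affine /= mulrC [f x * _]mulrC.
Qed.

Lemma Rintegral_kl_affine k r v f : slope_fun k r -> integrableR v -> integrableR f ->
  \int[mu]_x kl_affine (r x) (v x) (f x) =
  \int[mu]_x (v x * (1 - r x)) + \int[mu]_x (f x * ln (r x)).
Proof.
move=> /slope_fun_bounded[b1 b2] iv jf; rewrite -RintegralD//; last 2 first.
- exact: integrableR_mul.
- exact: integrableR_mul.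
by apply: eq_Rintegral => x _; rewrite /kl_affine mulrC [ln _ * _]mulrC.
Qed.

(** If v or f is not nonnegative almost everywhere, the right-hand side is
    infinite. *)
Lemma Rintegral_kl_affine_le k r v f : slope_fun k r ->
  integrableR v -> integrableR f ->
  ((\int[mu]_x kl_affine (r x) (v x) (f x))%:E <= KL mu v f)%E.
Proof.
move=> kr iv jf; have [|nv] := pselect (ae_ge0 mu v /\ ae_ge0 mu f); last first.
  by rewrite /KL asboolF// leey.
move=> [v0 f0]; rewrite KLE//.
have mv := integrableR_measurable iv; have mf := integrableR_measurable jf.
have pos_int w : integrableR w -> integrableR (fun x => maxr (w x) 0).
  move=> iw; apply: (le_integrable measurableT _ _ iw).
    apply/measurable_EFinP; apply: measurable_maxr => //; exact: integrableR_measurable.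
  by move=> x _ /=; rewrite lee_fin maxEle; case: ifP => // _; rewrite normr0.
have -> : \int[mu]_x kl_affine (r x) (v x) (f x) =
    \int[mu]_x kl_affine (r x) (maxr (v x) 0) (maxr (f x) 0).
  apply: Rintegral_ae_eq.
  - exact: integrableR_measurable (integrableR_kl_affine kr iv jf).
  - by apply: integrableR_measurable (integrableR_kl_affine kr _ _); exact: pos_int.
  - by move: v0 f0; apply: filterS2 => x v0 f0; rewrite !max_l.
have ia : integrableR (fun x => kl_affine (r x) (maxr (v x) 0) (maxr (f x) 0)).
  by apply: integrableR_kl_affine kr _ _; exact: pos_int.
set K := (\int[mu]_x kl_density _ _)%E.
have [Ky|Kfin] := eqVneq K +oo%E; first by rewrite Ky leey.
have m0 x : 0 <= maxr (v x) 0 /\ 0 <= maxr (f x) 0 by rewrite !le_max lexx !orbT.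
rewrite /Rintegral fineK; last exact: integrable_fin_num.
apply: le_integral => //.
- apply/integrableP; split.
    by apply: measurable_kl_density; apply: measurable_maxr.
  rewrite (eq_integral (fun x => kl_density (maxr (v x) 0) (maxr (f x) 0))).
    by rewrite ltey.
  by move=> x _; rewrite gee0_abs// kl_density_ge0//; have [] := m0 x.
- move=> x _; apply: kl_affine_le; first exact: slope_fun_gt0 kr.
  + by have [] := m0 x.
  + by have [] := m0 x.
Qed.

Lemma KL_ge0 v f : integrableR v -> integrableR f -> (0 <= KL mu v f)%E.
Proof.
move=> iv jf; have k1 : slope_fun 0 ((fun=> 1) : T -> R).
  by split=> // x; rewrite invr1 lexx.
apply: le_trans (Rintegral_kl_affine_le k1 iv jf).
by rewrite lee_fin; apply: Rintegral_ge0 => x _; rewrite kl_affine1.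
Qed.

(** The test function is the indicator of the set where v < 0. *)
Lemma not_ae_ge0_test v : integrableR v -> ~ ae_ge0 mu v ->
  exists2 phi, bounded_mfun phi /\ (forall x, 0 <= phi x) &
    \int[mu]_x (v x * phi x) < 0.
Proof.
move=> iv nv; have mv := integrableR_measurable iv.
pose phi x : R := if v x < 0 then 1 else 0.
have bphi : bounded_mfun phi.
  split; first by apply: measurable_fun_ifT => //; exact: measurable_fun_ltr.
  by exists 1 => x; rewrite /phi; case: ifP; rewrite ?normr1// normr0.
exists phi; first by split => // x; rewrite /phi; case: ifP.
rewrite ltNge; apply/negP => h; apply: nv.
have e x : v x * phi x = - `|v x * phi x|.
  rewrite /phi; case: ltP => v0; last by rewrite mulr0 normr0 oppr0.
  by rewrite mulr1 ltr0_norm// opprK.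
have ia := integrableR_mul iv bphi.
have : \int[mu]_x `|v x * phi x| = 0.
  apply/eqP; rewrite eq_le; apply/andP; split; last by apply: Rintegral_ge0.
  rewrite -oppr_ge0; apply: le_trans h _.
  have -> : - (\int[mu]_x `|v x * phi x|) = \int[mu]_x (-1 * `|v x * phi x|).
    rewrite RintegralZl ?mulN1r//; exact: (integrable_norm ia).
  by under eq_Rintegral do rewrite e -mulN1r.
move=> h0.
have /ae_eq_integral_abs : measurable_fun setT (EFin \o (fun x => v x * phi x)).
  exact/measurable_EFinP/integrableR_measurable.
move=> /(_ mu measurableT)[+ _].
have := integrable_norm ia => /integrable_fin_num-/(_ measurableT) hfin.
have {}h0 : (\int[mu]_x `|(v x * phi x)%:E| = 0)%E.
  by rewrite -[LHS]fineK//; congr EFin.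
move=> /(_ h0); apply: filterS => x /(_ I) /= [] /eqP.
rewrite /phi; case: (ltP (v x) 0) => // v0.
by rewrite mulr1 => /eqP v00; rewrite v00 ltxx in v0.
Qed.

(** A limit with a negative part has a negative integral against some
    nonnegative test function, hence so have the terms of large index. *)
Lemma weak_L1_cvg_neg vn v : (forall n, integrableR (vn n)) -> integrableR v ->
  weak_L1_cvg vn v -> ~ ae_ge0 mu v -> \forall n \near \oo, ~ ae_ge0 mu (vn n).
Proof.
move=> ivn iv vnv /(not_ae_ge0_test iv)[phi [bphi phi0] lt0].
have := vnv _ bphi => /cvgr_lt/(_ _ lt0); apply: filterS => n + vn0.
rewrite ltNge => /negP; apply.
rewrite (@Rintegral_ae_eq _ (fun x => maxr (vn n x) 0 * phi x)).
- by apply: Rintegral_ge0 => x _; rewrite mulr_ge0// le_max lexx orbT.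
- exact/integrableR_measurable/integrableR_mul.
- apply: measurable_funM => //; last exact: bphi.1.
  by apply: measurable_maxr => //; exact: integrableR_measurable.
- by apply: filterS vn0 => x v0; rewrite max_l.
Qed.

(** Along the sequence, the divergence is bounded below by the integral of the
    affine minorant whose slope is computed from the limit (v, f); this integral
    converges, and its limit tends to KL(v, f) as k grows. If v or f fails to be
    nonnegative, so do the terms of large index and their divergence is
    infinite. *)
Lemma KL_lsc vn fn v f :
  (forall n, integrableR (vn n)) -> (forall n, integrableR (fn n)) ->
  integrableR v -> integrableR f -> weak_L1_cvg vn v -> weak_L1_cvg fn f ->
  (KL mu v f <= limn_einf (fun n => KL mu (vn n) (fn n)))%E.
Proof.
move=> ivn jfn iv jf vnv fnf.
have [[v0 f0]|nneg] := pselect (ae_ge0 mu v /\ ae_ge0 mu f); last first.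
  have : \forall n \near \oo, ~ (ae_ge0 mu (vn n) /\ ae_ge0 mu (fn n)).
    have [nv|nf] : ~ ae_ge0 mu v \/ ~ ae_ge0 mu f by exact/not_andP.
      by have := weak_L1_cvg_neg ivn iv vnv nv; apply: filterS => n + [].
    by have := weak_L1_cvg_neg jfn jf fnf nf; apply: filterS => n + [].
  move=> h; apply/le_limn_einfP => a _; apply: filterS h => n nn.
  by rewrite /KL asboolF// ltry.
rewrite KLE//.
have mv := integrableR_measurable iv; have mf := integrableR_measurable jf.
have m0 x : 0 <= maxr (v x) 0 /\ 0 <= maxr (f x) 0 by rewrite !le_max lexx !orbT.
pose r k x := kl_slope k (maxr (v x) 0) (maxr (f x) 0).
have kr k : slope_fun k (r k).
  split=> [|x]; last exact: kl_slope_bounded.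
  by apply: measurable_kl_slope; apply: measurable_maxr.
apply: (@limn_einf_ge_integral _
  (fun k x => (kl_affine (r k x) (maxr (v x) 0) (maxr (f x) 0))%:E)).
- move=> k; apply/measurable_EFinP; apply: measurable_funD.
    apply: measurable_funM; first exact: (slope_fun_bounded (kr k)).1.1.
    exact: measurable_maxr.
  apply: measurable_funM; first exact: (slope_fun_bounded (kr k)).2.1.
  exact: measurable_maxr.
- by move=> k x; have [] := m0 x => *; rewrite lee_fin kl_affine_slope_ge0.
- by move=> x; have [] := m0 x => *; exact: cvg_kl_affine_slope.
move=> k.
have -> : (\int[mu]_x (kl_affine (r k x) (maxr (v x) 0) (maxr (f x) 0))%R%:E =
    (\int[mu]_x kl_affine (r k x) (v x) (f x))%:E)%E.
  have ia := integrableR_kl_affine (kr k) iv jf.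
  rewrite /Rintegral fineK; last exact: integrable_fin_num.
  apply: ae_eq_integral => //.
  - apply/measurable_EFinP; apply: measurable_funD.
      apply: measurable_funM; first exact: (slope_fun_bounded (kr k)).1.1.
      exact: measurable_maxr.
    apply: measurable_funM; first exact: (slope_fun_bounded (kr k)).2.1.
    exact: measurable_maxr.
  - exact/measurable_EFinP/integrableR_measurable.
  - by move: v0 f0; apply: filterS2 => x v0 f0 _; rewrite !max_l.
apply: (@limn_einf_ge_real _ (fun n => \int[mu]_x kl_affine (r k x) (vn n x) (fn n x))).
  rewrite (Rintegral_kl_affine (kr k))//.
  under eq_fun do rewrite (Rintegral_kl_affine (kr k))//.
  have [b1 b2] := slope_fun_bounded (kr k).
  by apply: cvgD; [exact: vnv|exact: fnf].
by move=> n; exact: Rintegral_kl_affine_le (kr k) _ _.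
Qed.

End WeakL1.

(** * Norm estimates and dependence of KL on the data *)

Section Norms.
#[local] Set Implicit Arguments.
#[local] Unset Strict Implicit.
Context {d} {T : measurableType d} {R : realType}.
Variable mu : {measure set T -> \bar R}.
Hypothesis muT : (mu setT < +oo)%E.
Implicit Types (v f r phi : T -> R).

Lemma norm2_sqr v : (norm2 mu v ^+ 2 = \int[mu]_x ((v x) ^+ 2)%:E)%E.
Proof.
rewrite /norm2 unlock poweR12_sqrt ?integral_ge0// => [|x _]; last first.
  by rewrite lee_fin powR_ge0.
rewrite sqr_sqrte ?integral_ge0// => [|x _]; last by rewrite lee_fin powR_ge0.
by apply: eq_integral => x _ /=; rewrite powR_mulrn// real_normK// num_real.
Qed.

(** The inequality w ^ 2 >= 2 r w - r ^ 2 is used with r equal to the limit v,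
    truncated to 0 where |v| exceeds k. *)
Lemma norm2_lsc vn v :
  (forall n, integrableR mu (vn n)) -> integrableR mu v -> weak_L1_cvg mu vn v ->
  (norm2 mu v ^+ 2 <= limn_einf (fun n => norm2 mu (vn n) ^+ 2))%E.
Proof.
move=> ivn iv vnv; have mv := integrableR_measurable iv; rewrite norm2_sqr.
pose r (k : nat) x := if `|v x| <= k%:R then v x else 0.
have br k : bounded_mfun (r k).
  split; first by apply: measurable_fun_ifT => //; apply: measurable_fun_ler => //;
    exact: measurableT_comp.
  by exists k%:R => x; rewrite /r; case: ifP => //; rewrite normr0.
have br2 k : bounded_mfun (fun x => r k x ^+ 2).
  have [mr [M hM]] := br k; split; first exact: measurable_funX.
  exists (M ^+ 2) => x; rewrite normrX lerXn2r// nnegrE//.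
  exact: le_trans (hM x).
have i2 w k : integrableR mu w ->
    integrableR mu (fun x => 2 * (w x * r k x) - r k x ^+ 2).
  move=> iw; apply: integrableR_B.
    by apply: (integrableR_Z 2 (integrableR_mul iw (br k))).
  exact: (bounded_integrableR muT (br2 k)).
have e w k : integrableR mu w -> \int[mu]_x (2 * (w x * r k x) - r k x ^+ 2) =
    2 * \int[mu]_x (w x * r k x) - \int[mu]_x (r k x ^+ 2).
  move=> iw; have iwr := integrableR_mul iw (br k).
  rewrite RintegralB// ?RintegralZl//.
    exact: (integrableR_Z 2 iwr).
  exact: (bounded_integrableR muT (br2 k)).
apply: (@limn_einf_ge_integral _ _ _ mu _ (fun k x => (r k x ^+ 2)%:E)).
- by move=> k; apply/measurable_EFinP; exact: (br2 k).1.
- by move=> k x; rewrite lee_fin sqr_ge0.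
- move=> x; apply: cvg_near_cst; near=> k.
  rewrite /r ifT//; near: k; exact: nbhs_infty_ger.
move=> k.
have -> : (\int[mu]_x (r k x ^+ 2)%:E =
    (\int[mu]_x (2 * (v x * r k x) - r k x ^+ 2))%:E)%E.
  rewrite -[LHS]fineK.
    congr EFin; apply: eq_Rintegral => x _; rewrite /r; case: ifP => _; ring.
  exact: integrable_fin_num (bounded_integrableR muT (br2 k)).
apply: (@limn_einf_ge_real _ _
    (fun n => \int[mu]_x (2 * (vn n x * r k x) - r k x ^+ 2))).
  rewrite e//; under eq_fun do rewrite e//.
  by apply: cvgB; [apply: cvgMr; exact: vnv|exact: cvg_cst].
move=> n; rewrite norm2_sqr /Rintegral fineK; last first.
  exact: integrable_fin_num (i2 _ k (ivn n)).
have mvn := integrableR_measurable (ivn n).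
have [->|nfin] := eqVneq (\int[mu]_x (vn n x ^+ 2)%:E)%E +oo%E; first by rewrite leey.
apply: le_integral => //.
- exact: i2.
- apply/integrableP; split; first by apply/measurable_EFinP; exact: measurable_funX.
  rewrite (eq_integral (fun x => (vn n x ^+ 2)%:E)) ?ltey// => x _.
  by rewrite /= ger0_norm// sqr_ge0.
- move=> x _; rewrite lee_fin -subr_ge0.
  have -> : vn n x ^+ 2 - (2 * (vn n x * r k x) - r k x ^+ 2) = (vn n x - r k x) ^+ 2.
    by ring.
  exact: sqr_ge0.
Unshelve. all: by end_near. Qed.

Lemma Lnorm_EFin (p : R) v :
  ('N[mu]_p%:E [EFin \o v] = (\int[mu]_x (`|v x| `^ p)%:E) `^ p^-1)%E.
Proof. by rewrite unlock. Qed.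

(** Hoelder's inequality for the functions |v| ^ p and 1 with exponents q / p and
    its conjugate. *)
Lemma Lnorm_le_finite (p q : R) : 1 <= p -> p <= q ->
  exists2 K : R, 0 <= K & forall v, measurable_fun setT v ->
    ('N[mu]_p%:E [EFin \o v] <= K%:E * 'N[mu]_q%:E [EFin \o v])%E.
Proof.
move=> p1; rewrite le_eqVlt => /predU1P[<-|pq].
  by exists 1 => // v _; rewrite mul1e.
have p0 : 0 < p by apply: lt_le_trans p1.
have q0 : 0 < q by apply: lt_trans pq.
pose r := q / p; pose s := (1 - r^-1)^-1.
have rs : r^-1 + s^-1 = 1 by rewrite /s invrK subrKC.
have r0 : 0 < r by rewrite divr_gt0.
have s0 : 0 < s.
  by rewrite invr_gt0 subr_gt0 invf_lt1// ltr_pdivlMr// mul1r.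
have muTfin : mu setT \is a fin_num by rewrite ge0_fin_numE.
exists (fine ((mu setT `^ s^-1) `^ p^-1)%E); first by rewrite fine_ge0// poweR_ge0.
move=> v mv; rewrite fineK; last by rewrite !fin_num_poweR.
have mvp : measurable_fun setT (fun x => `|v x| `^ p).
  apply: (measurableT_comp (@measurable_powR R p)); exact: measurableT_comp.
have := @hoelder _ _ _ mu (fun x => `|v x| `^ p) (cst 1) r s mvp
  (measurable_cst _) r0 s0 rs.
rewrite Lnorm_cst1 Lnorm1.
under eq_integral do rewrite /= mulr1 ger0_norm ?powR_ge0//.
move=> h; rewrite Lnorm_EFin.
have A0 : (0 <= \int[mu]_x (`|v x| `^ p)%:E)%E.
  by apply: integral_ge0 => x _; rewrite lee_fin powR_ge0.
apply: (@le_trans _ _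
  (('N[mu]_r%:E [EFin \o (fun x => `|v x| `^ p)%R] * mu setT `^ s^-1) `^ p^-1)%E).
  apply: gt0_ler_poweR => //; rewrite ?in_itv/= ?A0 ?leey//.
    by rewrite invr_ge0 ltW.
  by rewrite mule_ge0 ?Lnorm_ge0 ?poweR_ge0.
rewrite poweRM ?Lnorm_ge0 ?poweR_ge0// muleC lee_wpmul2l ?poweR_ge0//.
rewrite !Lnorm_EFin -poweRrM.
have -> : r^-1 * p^-1 = q^-1 by rewrite /r; field; rewrite !gt_eqF.
rewrite le_eqVlt; apply/orP; left; apply/eqP; congr poweR.
apply: eq_integral => x _; rewrite ger0_norm ?powR_ge0// -powRrM.
by congr EFin; congr powR; rewrite /r; field; rewrite gt_eqF.
Qed.

Lemma Lnorm_distrC (p : R) v f :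
  ('N[mu]_p%:E [EFin \o (fun x => v x - f x)%R] =
   'N[mu]_p%:E [EFin \o (fun x => f x - v x)%R])%E.
Proof. by rewrite !Lnorm_EFin; under eq_integral do rewrite distrC. Qed.

Lemma Lnorm_triangle (p : R) v f : 1 <= p ->
  measurable_fun setT v -> measurable_fun setT f ->
  ('N[mu]_p%:E [EFin \o v] <=
   'N[mu]_p%:E [EFin \o (fun x => v x - f x)%R] + 'N[mu]_p%:E [EFin \o f])%E.
Proof.
move=> p1 mv mf; apply: le_trans (eminkowski _ _ mf _) => //.
  by rewrite !Lnorm_EFin; under [in leRHS]eq_integral do rewrite /= subrK.
exact: measurable_funB.
Qed.

Lemma Lnorm_le_addr (p : R) v f : 1 <= p ->
  measurable_fun setT v -> measurable_fun setT f ->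
  ('N[mu]_p%:E [EFin \o v] <=
   'N[mu]_p%:E [EFin \o (fun x => v x + f x)%R] + 'N[mu]_p%:E [EFin \o f])%E.
Proof.
move=> p1 mv mf.
have mNf : measurable_fun setT (fun x => - f x) by exact: measurableT_comp.
apply: le_trans (Lnorm_triangle p1 mv mNf) _.
rewrite !Lnorm_EFin; under eq_integral do rewrite opprK.
by under [X in (_ + X `^ _)%E]eq_integral do rewrite normrN.
Qed.

Lemma norm1E v : norm1 mu v = (\int[mu]_x (`|v x|)%:E)%E.
Proof. by rewrite /norm1 Lnorm1. Qed.

Lemma Rintegral_norm v : integrableR mu v ->
  norm1 mu v = (\int[mu]_x `|v x|)%:E.
Proof.
move=> iv; rewrite norm1E /Rintegral fineK//.
exact: integrable_fin_num (integrableR_norm iv).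
Qed.

Lemma Rintegral_mul_le v phi M : integrableR mu v -> measurable_fun setT phi ->
  (forall x, `|phi x| <= M) -> `|\int[mu]_x (v x * phi x)| <= M * \int[mu]_x `|v x|.
Proof.
move=> iv mphi hM; have bphi : bounded_mfun phi by split => //; exists M.
have ivp := integrableR_mul iv bphi.
apply: (le_trans (le_normr_Rintegral measurableT ivp)).
rewrite -RintegralZl//; last exact: (integrableR_norm iv).
apply: le_Rintegral => //.
- exact: (integrableR_norm ivp).
- by apply: (integrableR_Z M (integrableR_norm iv)).
- by move=> x _; rewrite normrM mulrC ler_wpM2r.
Qed.

Lemma weak_L1_cvg_strong fn f :
  (forall n, integrableR mu (fn n)) -> integrableR mu f ->
  norm1 mu (fun x => f x - fn n x) @[n --> \oo] --> 0%E -> weak_L1_cvg mu fn f.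
Proof.
move=> ifn jf h phi bphi; have [mphi [M hM]] := bphi.
have id n : integrableR mu (fun x => f x - fn n x).
  by apply: integrableR_B => //; exact: ifn.
have {}h : \int[mu]_x `|f x - fn n x| @[n --> \oo] --> 0.
  have /fine_cvgP[_] := h; apply: cvg_trans; apply: near_eq_cvg.
  by apply: nearW => n /=; rewrite Rintegral_norm.
apply: (iffLR (subr_cvg0 _ _)); apply: norm_cvg0.
have hMe n : `|\int[mu]_x (fn n x * phi x) - \int[mu]_x (f x * phi x)| <=
    M * \int[mu]_x `|f x - fn n x|.
  rewrite distrC -RintegralB//; last 2 first.
  - exact: integrableR_mul.
  - exact: integrableR_mul.
  under eq_Rintegral do rewrite -mulrBl.
  exact: Rintegral_mul_le.
apply: (@squeeze_cvgr _ _ _ _ (cst 0) (fun n => M * \int[mu]_x `|f x - fn n x|)).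
- by apply: nearW => n; rewrite hMe normr_ge0.
- exact: cvg_cst.
- by rewrite -[X in _ --> X](mulr0 M); apply: cvgMr.
Qed.

Lemma weak_L1_cvg_lincomb vn v wn w (a : R) :
  (forall n, integrableR mu (vn n)) -> integrableR mu v ->
  (forall n, integrableR mu (wn n)) -> integrableR mu w ->
  weak_L1_cvg mu vn v -> weak_L1_cvg mu wn w ->
  weak_L1_cvg mu (fun n x => vn n x + a * wn n x) (fun x => v x + a * w x).
Proof.
move=> ivn iv iwn iw vnv wnw phi bphi.
have E v' w' : integrableR mu v' -> integrableR mu w' ->
    \int[mu]_x ((v' x + a * w' x) * phi x) =
    \int[mu]_x (v' x * phi x) + a * \int[mu]_x (w' x * phi x).
  move=> iv' iw'.
  rewrite -RintegralZl//; last exact: integrableR_mul.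
  rewrite -RintegralD//; last 2 first.
  - exact: integrableR_mul.
  - exact: (integrableR_Z a (integrableR_mul iw' bphi)).
  by apply: eq_Rintegral => x _; ring.
rewrite E//; under eq_fun do rewrite E//.
by apply: cvgD; [exact: vnv|apply: cvgMr; exact: wnw].
Qed.

Lemma weak_L1_cvgD vn v wn w :
  (forall n, integrableR mu (vn n)) -> integrableR mu v ->
  (forall n, integrableR mu (wn n)) -> integrableR mu w ->
  weak_L1_cvg mu vn v -> weak_L1_cvg mu wn w ->
  weak_L1_cvg mu (fun n x => vn n x + wn n x) (fun x => v x + w x).
Proof.
move=> ivn iv iwn iw vnv /(weak_L1_cvg_lincomb (a := 1) ivn iv iwn iw vnv).
congr weak_L1_cvg; last by apply/funext => x; rewrite mul1r.
by apply/funext => n; apply/funext => x; rewrite mul1r.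
Qed.

Lemma weak_L1_cvgB vn v wn w :
  (forall n, integrableR mu (vn n)) -> integrableR mu v ->
  (forall n, integrableR mu (wn n)) -> integrableR mu w ->
  weak_L1_cvg mu vn v -> weak_L1_cvg mu wn w ->
  weak_L1_cvg mu (fun n x => vn n x - wn n x) (fun x => v x - w x).
Proof.
move=> ivn iv iwn iw vnv /(weak_L1_cvg_lincomb (a := -1) ivn iv iwn iw vnv).
congr weak_L1_cvg; last by apply/funext => x; rewrite mulN1r.
by apply/funext => n; apply/funext => x; rewrite mulN1r.
Qed.

(** The affine minorant of slope r = 1/2 is v / 2 - ln 2 * f. *)
Lemma norm1_le_KL v f : integrableR mu v -> integrableR mu f ->
  (norm1 mu v <= 2%:E * KL mu v f + (2 * ln 2)%:E * norm1 mu f)%E.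
Proof.
move=> iv jf; have [|nv] := pselect (ae_ge0 mu v /\ ae_ge0 mu f); last first.
  rewrite {1}/KL asboolF// gt0_muley ?lte_fin// addye ?leey//.
  by rewrite Rintegral_norm.
move=> [v0 f0].
have hs : slope_fun 1 ((fun=> 2^-1) : T -> R).
  by split=> // x; rewrite lexx /= (le_trans (y := 1))// ?ler1n// invf_le1// ler1n.
have := Rintegral_kl_affine_le hs iv jf.
case: (KL mu v f) (KL_ge0 iv jf) => [k| |]// _.
  rewrite (Rintegral_kl_affine hs)// !RintegralZr// !Rintegral_norm//.
  rewrite -!EFinM -EFinD !lee_fin.
  rewrite lnV ?posrE//.
  have ev w : ae_ge0 mu w -> integrableR mu w -> \int[mu]_x `|w x| = \int[mu]_x w x.
    move=> w0 iw; apply: Rintegral_ae_eq.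
    - exact: (integrableR_measurable (integrableR_norm iw)).
    - exact: (integrableR_measurable iw).
    - by apply: filterS w0 => x ?; rewrite ger0_norm.
  rewrite !ev//; lra.
by rewrite gt0_muley ?lte_fin// addye ?leey// Rintegral_norm.
Qed.

Section KLContinuity.
Variables (v f : T -> R) (b0 b1 : R).
Hypotheses (iv : integrableR mu v) (jf : integrableR mu f).
Hypotheses (b00 : 0 < b0) (b10 : 0 < b1) (f0 : ae_ge0 mu f).
Hypothesis vf : {ae mu, forall x, b1 * f x <= v x <= b0 * f x}.

(** The logarithm of v / f, set to 0 off the set where f > 0 and the two-sided
    bound holds; this makes it bounded everywhere, and nothing is lost because
    the two-sided bound holds almost everywhere and forces v = 0 where f = 0. *)
Definition log_ratio x := if (0 < f x) && (b1 * f x <= v x <= b0 * f x)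
  then ln (v x / f x) else 0.

Lemma bounded_log_ratio : bounded_mfun log_ratio.
Proof.
have mv := integrableR_measurable iv; have mf := integrableR_measurable jf.
split.
  apply: measurable_fun_ifT => //.
    apply: measurable_and; first exact: measurable_fun_ltr.
    by apply: measurable_and; apply: measurable_fun_ler => //; exact: measurable_funM.
  apply: (measurableT_comp (@measurable_ln R)); apply: measurable_funM => //.
  exact: measurable_funV.
exists (`|ln b0| + `|ln b1|) => x; rewrite /log_ratio; case: ifP; last first.
  by move=> _; rewrite normr0 addr_ge0.
move=> /andP[fx /andP[h1 h2]].
have vx : 0 < v x by apply: lt_le_trans h1; rewrite mulr_gt0.
have : ln (v x / f x) <= ln b0 by rewrite ler_ln ?posrE ?divr_gt0// ler_pdivrMr.
have : ln b1 <= ln (v x / f x) by rewrite ler_ln ?posrE ?divr_gt0// ler_pdivlMr.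
move=> l1 l2; rewrite ler_norml; apply/andP; split.
- have := ler_norm (- ln b1); rewrite normrN; have := normr_ge0 (ln b0); lra.
- have := ler_norm (ln b0); have := normr_ge0 (ln b1); lra.
Qed.

(** Wherever f > 0 this is log (v / b) = log (f / b) + log (v / f). *)
Lemma kl_density_shift x (b : R) : 0 <= f x -> 0 <= b -> b1 * f x <= v x <= b0 * f x ->
  kl_density (v x) b = (kl_density (f x) b + (v x - f x - b * log_ratio x)%:E)%E.
Proof.
move=> fx bx /[dup] /andP[h1 h2] h; rewrite /log_ratio h andbT.
have [fx0|fx0] := ltP 0 (f x); last first.
  have fe : f x = 0 by apply/eqP; rewrite eq_le fx0.
  have ve : v x = 0.
    by apply/eqP; rewrite eq_le; move: h1 h2; rewrite fe !mulr0 => -> ->.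
  by rewrite fe ve mulr0 !subr0 adde0.
have vx : 0 < v x by apply: lt_le_trans h1; rewrite mulr_gt0.
rewrite /kl_density /mul_log_div !(gt_eqF fx0) !(gt_eqF vx).
have [->|bn] := eqVneq b 0; first by rewrite -!EFinB -EFinD; congr EFin; ring.
have b_gt0 : 0 < b by rewrite lt_neqAle eq_sym bn.
by rewrite -!EFinB -EFinD !ln_div ?posrE//; congr EFin; ring.
Qed.

(** Finiteness of KL(f, b) makes its integrand integrable, so that
    [kl_density_shift] can be integrated term by term. *)
Lemma KL_shift b : integrableR mu b -> (KL mu f b < +oo)%E ->
  KL mu v b = (KL mu f b + (\int[mu]_x (v x - f x - b x * log_ratio x))%:E)%E.
Proof.
move=> ib KLfin.
have mv := integrableR_measurable iv; have mf := integrableR_measurable jf.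
have mb := integrableR_measurable ib.
have b_ge0 : ae_ge0 mu b.
  by move: KLfin; rewrite /KL; case: asboolP => [[]|]; rewrite ?ltxx.
have v_ge0 : ae_ge0 mu v.
  move: f0 vf; apply: filterS2 => x fx /andP[+ _]; apply: le_trans.
  by rewrite mulr_ge0// ltW.
have il : integrableR mu (fun x => v x - f x - b x * log_ratio x).
  apply: integrableR_B; first exact: integrableR_B.
  exact: integrableR_mul bounded_log_ratio.
have ik : mu.-integrable setT (fun x => kl_density (f x) (b x)).
  apply/integrableP; split; first exact: measurable_kl_density.
  move: KLfin; rewrite /KL asboolT//; congr (_ < _)%E; apply: ae_eq_integral => //.
  - exact: measurable_kl_density.
  - by apply: measurableT_comp => //; exact: measurable_kl_density.
  - by move: f0 b_ge0; apply: filterS2 => x fx bx _; rewrite gee0_abs// kl_density_ge0.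
rewrite /KL !asboolT// /Rintegral fineK; last exact: integrable_fin_num il.
rewrite -integralD//; apply: ae_eq_integral => //.
- exact: measurable_kl_density.
- by apply: emeasurable_funD;
    [exact: measurable_kl_density|exact/measurable_EFinP/(integrableR_measurable il)].
- move: (f0) b_ge0 (vf); apply: filterS3 => x fx bx vfx _.
  exact: kl_density_shift.
Qed.

Lemma KL_self : KL mu f f = 0%E.
Proof.
rewrite /KL asboolT//.
have mf := integrableR_measurable jf.
rewrite (ae_eq_integral (cst 0%E))//; first by rewrite integral0.
  exact: measurable_kl_density.
apply: filterS f0 => x fx _; rewrite /mul_log_div.
have [->|fn] := eqVneq (f x) 0; first by rewrite !sube0.
by rewrite divff// ln1 mulr0 subee// sube0.
Qed.

(** By [KL_shift], the only dependence on the datum besides KL(f, f^n) is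
    through the integral of f^n times a bounded function. *)
Lemma cvg_KL fn : (forall n, integrableR mu (fn n)) -> weak_L1_cvg mu fn f ->
  KL mu f (fn n) @[n --> \oo] --> 0%E ->
  KL mu v (fn n) @[n --> \oo] --> KL mu v f.
Proof.
move=> ifn fnf h.
have fin : \forall n \near \oo, (KL mu f (fn n) < +oo)%E.
  by have /fine_cvgP[+ _] := h; apply: filterS => n /fin_numPlt/andP[].
rewrite KL_shift// ?KL_self// ?ltry//.
have E b : integrableR mu b -> \int[mu]_x (v x - f x - b x * log_ratio x) =
    \int[mu]_x (v x - f x) - \int[mu]_x (b x * log_ratio x).
  move=> ib; rewrite RintegralB//; first exact: integrableR_B.
  exact: integrableR_mul bounded_log_ratio.
have : (KL mu f (fn n) + (\int[mu]_x (v x - f x - fn n x * log_ratio x))%:E)%E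
    @[n --> \oo] --> (0 + (\int[mu]_x (v x - f x - f x * log_ratio x))%:E)%E.
  apply: cvgeD => //.
  apply: cvg_EFin; first exact: nearW.
  rewrite /comp /= E//; under eq_fun do rewrite E//.
  by apply: cvgB; [exact: cvg_cst|exact: fnf bounded_log_ratio].
apply: cvg_trans; apply: near_eq_cvg; apply: filterS fin => n nfin.
by rewrite KL_shift.
Qed.

End KLContinuity.

End Norms.

(** * Bounded operators between Lebesgue spaces *)

Section LebesgueSpaces.
#[local] Set Implicit Arguments.
#[local] Unset Strict Implicit.
Context {R : realType}.

Section OneSpace.
Context {d} {T : measurableType d} {mu : {measure set T -> \bar R}} {p : R}
  {p1 : (1 <= p%:E)%E}.
Hypothesis muT : (mu setT < +oo)%E.
Implicit Types u v w : LspaceType mu p1.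

Lemma Lspace_measurable u : measurable_fun setT (u : T -> R).
Proof. exact: (@measurable_funPT _ _ _ _ (repr (LebesgueSpace.sort u))). Qed.

Lemma Lpnorm_lty u : (Lpnorm u < +oo)%E.
Proof. exact: Lebesgue_finite. Qed.

Lemma Lpnorm_fin u : Lpnorm u \is a fin_num.
Proof. by rewrite ge0_fin_numE ?Lnorm_ge0// Lpnorm_lty. Qed.

Lemma norm1_le_Lpnorm : exists2 K : R, 0 <= K &
  forall u, (norm1 mu u <= K%:E * Lpnorm u)%E.
Proof.
have [K K0 hK] := Lnorm_le_finite muT (lexx 1) p1.
exists K => // u; exact: hK (Lspace_measurable u).
Qed.

Lemma Lspace_integrable u : integrableR mu u.
Proof.
have [K K0 hK] := norm1_le_Lpnorm.
apply/integrableP; split; first exact/measurable_EFinP/Lspace_measurable.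
apply: (@le_lt_trans _ _ (K%:E * Lpnorm u)%E); first by have := hK u; rewrite norm1E.
by apply: lte_mul_pinfty => //; exact: Lpnorm_lty.
Qed.

End OneSpace.

(** The map u |-> integral of A(u_i) * phi is a bounded linear form on the
    product space: its norm is controlled by the bound of phi, the embedding of
    L^q in L^1 on a space of finite measure, and the bound of A. *)
Lemma weak_cvg_op (N : nat) {d1 d2} {T1 : measurableType d1} {T2 : measurableType d2}
    {mu : {measure set T1 -> \bar R}} {nu : {measure set T2 -> \bar R}} {p : \bar R}
    {q : R} {p1 : (1 <= p)%E} {q1 : (1 <= q%:E)%E}
    (A : LspaceType mu p1 -> LspaceType nu q1)
    (un : nat -> 'I_N -> LspaceType mu p1) u (i : 'I_N) :
  (nu setT < +oo)%E -> bounded_linear_op A -> weak_cvg un u ->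
  weak_L1_cvg nu (fun n => A (un n i)) (A (u i)).
Proof.
move=> nuT [Alin [C AC]] unu phi bphi.
apply: (unu (fun w => \int[nu]_x ((A (w i) : T2 -> R) x * phi x))).
have iA w : integrableR nu (A w) by exact: Lspace_integrable.
split.
  move=> a v w z hz; rewrite -RintegralZl//; last exact: integrableR_mul (iA _) bphi.
  rewrite -RintegralD//; last 2 first.
  - exact: integrableR_Z (integrableR_mul (iA _) bphi).
  - exact: integrableR_mul (iA _) bphi.
  apply: (@Rintegral_ae_eq _ _ _ nu).
  - exact: integrableR_measurable (integrableR_mul (iA _) bphi).
  - apply: (@integrableR_measurable _ _ _ nu); apply: integrableR_D.
      exact: integrableR_Z (integrableR_mul (iA _) bphi).
    exact: integrableR_mul (iA _) bphi.
  - have := Alin a _ _ _ (hz i); apply: filterS => x /(_ I) ->; ring.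
have [mphi [M hM]] := bphi.
have [K K0 hK] := @norm1_le_Lpnorm _ _ nu q q1 nuT.
exists (`|M| * (K * `|C|)) => w.
have h1 : ((`|\int[nu]_x ((A (w i) : T2 -> R) x * phi x)|)%:E <=
    `|M|%:E * norm1 nu (A (w i)))%E.
  rewrite Rintegral_norm// -EFinM lee_fin; apply: Rintegral_mul_le => //.
  by move=> x; apply: le_trans (hM x) (ler_norm M).
apply: (le_trans h1); rewrite EFinM -muleA lee_wpmul2l ?lee_fin//.
apply: (le_trans (hK _)); rewrite EFinM -muleA lee_wpmul2l ?lee_fin//.
apply: (le_trans (AC _)).
apply: (@le_trans _ _ (`|C|%:E * Lpnorm (w i))%E).
  by apply: lee_wpmul2r; [exact: Lnorm_ge0|rewrite lee_fin ler_norm].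
rewrite lee_wpmul2l ?lee_fin// (bigD1 i)//= leeDl// sume_ge0// => j _.
exact: Lnorm_ge0.
Qed.

(** The set is covered by a single box; the other sets of the cover are empty. *)
Lemma lebesgue_on_lty (n : nat) (D : set 'rV[R]_n) : bounded_set D ->
  (lebesgue_on D setT < +oo)%E.
Proof.
move=> [M [_ /(_ (M + 1))]]; rewrite ltrDl ltr01 => /(_ isT) hD.
rewrite lebesgue_onE setTI.
pose b : 'rV[R]_n := \row_i `|M + 1|.
pose F (k : nat) : set 'rV[R]_n := if k is 0%N then closed_box (- b) b else set0.
apply: (@le_lt_trans _ _ (\sum_(k <oo) box_volume (F k))%E).
  apply: ereal_inf_lbound; exists F => // x Dx; exists 0%N => // i.
  have := hD x Dx; rewrite /= !mxE => xM.
  rewrite -ler_norml; apply: le_trans (ler_norm (M + 1)).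
  apply: le_trans xM.
  rewrite [leRHS]/Num.norm /= mx_normrE.
  by apply: (le_bigmax _ (fun ij => `|x ij.1 ij.2|) (ord0, i)).
have v0 A : (0 <= @box_volume R n A)%E.
  apply: le_ereal_inf_tmp => _ [[_ ->//]|[a [c [ac _ ->]]]].
  by rewrite lee_fin; apply: prodr_ge0 => i _; rewrite subr_ge0.
rewrite (nneseries_split 0 1)// big_nat1 /= eseries0 ?adde0.
  apply: (@le_lt_trans _ _ (\prod_(i < n) (b ord0 i - (- b) ord0 i))%:E);
    last exact: ltry.
  apply: ereal_inf_lbound; right; exists (- b), b; split => // i.
  by rewrite !mxE (le_trans (y := 0))// oppr_le0.
move=> [|k]// _ _; apply/eqP; rewrite eq_le v0 andbT.
by apply: ereal_inf_lbound; left.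
Qed.

End LebesgueSpaces.

(** * Existence and stability of minimizers *)

Section Functional.
Context {R : realType} {N : nat} {Lnr Lkl : {set 'I_N}} {d : nat}
  {Om : set 'rV[R]_d} {p : R} {p1 : 1 < p} {m : 'I_N -> nat}
  {S : forall i, set 'rV[R]_(m i)}
  {B : forall i : idx Lkl, set (set 'rV[R]_(m (sval i)))}
  {mu : forall i : idx Lkl,
    {finite_measure set (g_sigma_algebraType (B i)) -> \bar R}}.
Hypothesis p2 : p <= 2.
Hypothesis hS : forall i : idx Lnr, bounded_set (S (sval i)).
Variables (Reg : ('I_N -> Lp Om p1) -> \bar R)
  (Tnr : forall i : idx Lnr, Lp Om p1 -> Lp (S (sval i)) p1)
  (Tkl : forall i : idx Lkl, Lp Om p1 -> L1 (mu i))
  (c : forall i : idx Lkl, L1 (mu i)).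
Hypothesis hReg : forall u, (0 <= Reg u)%E.
Hypothesis hNKL : assumption_NKL Reg Tnr Tkl.
Variable lambda : 'I_N -> R.
Hypothesis hlambda : forall i, 0 < lambda i.

#[local] Set Implicit Arguments.
#[local] Unset Strict Implicit.

Local Notation data := (data_space (Lnr := Lnr) (p1 := p1) (S := S) (mu := mu)).
Local Notation Jf := (J Reg Tnr Tkl c lambda).
Local Notation nu i := (lebesgue_on (S (sval i))).
Implicit Types (g gd : data) (gn : nat -> data).
Implicit Types (u v : 'I_N -> Lp Om p1) (un : nat -> 'I_N -> Lp Om p1).

Let nuT (i : idx Lnr) : (nu i setT < +oo)%E.
Proof. exact: lebesgue_on_lty. Qed.

Let muT (i : idx Lkl) : (mu i setT < +oo)%E.
Proof. by rewrite ltey_eq fin_num_measure. Qed.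

Let int_nr (i : idx Lnr) (w : Lp (S (sval i)) p1) : integrableR (nu i) w.
Proof. exact: Lspace_integrable. Qed.

Let int_kl (i : idx Lkl) (w : L1 (mu i)) : integrableR (mu i) w.
Proof. exact: (@Lspace_integrable _ _ _ _ 1 (lexx 1%E) (muT i) w). Qed.

Lemma nr_term_ge0 i u g : (0 <= nr_term Tnr i u g)%E.
Proof.
by rewrite /nr_term norm2_sqr integral_ge0// => x _; rewrite lee_fin sqr_ge0.
Qed.

Lemma kl_term_ge0 i u g : (0 <= kl_term Tkl c i u g)%E.
Proof. by apply: KL_ge0 => //; apply: integrableR_D. Qed.

Let lnr_ge0 i u g : (0 <= (lambda (sval i))%:E * nr_term Tnr i u g)%E.
Proof. by rewrite mule_ge0 ?nr_term_ge0// lee_fin ltW. Qed.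

Let lkl_ge0 i u g : (0 <= (lambda (sval i))%:E * kl_term Tkl c i u g)%E.
Proof. by rewrite mule_ge0 ?kl_term_ge0// lee_fin ltW. Qed.

Lemma J_ge0 g u : (0 <= Jf g u)%E.
Proof. by rewrite /J !adde_ge0// sume_ge0. Qed.

(** Joint lower semicontinuity of J is for the weak convergence of u and this
    convergence of the data. *)
Definition data_cvg gn gd : Prop :=
  (forall i, norm2 (nu i) (fun x => gd.1 i x - (gn n).1 i x) @[n --> \oo] --> 0%E) /\
  (forall i, norm1 (mu i) (fun x => gd.2 i x - (gn n).2 i x) @[n --> \oo] --> 0%E).

(** Only eventually do the data of a convergent sequence lie at finite distance
    from their limit, so the uniform estimates below are stated on a ball. *)
Definition data_near gd g : Prop :=
  (forall i, norm2 (nu i) (fun x => gd.1 i x - g.1 i x)%R <= 1)%E /\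
  (forall i, norm1 (mu i) (fun x => gd.2 i x - g.2 i x)%R <= 1)%E.

Lemma data_cvg_near gn gd : data_cvg gn gd -> \forall n \near \oo, data_near gd (gn n).
Proof.
move=> [h1 h2].
have E (I : finType) (P : I -> nat -> Prop) :
    (forall i, \forall n \near \oo, P i n) -> \forall n \near \oo, forall i, P i n.
  by move=> /filter_forall.
have H (a : (\bar R)^nat) : a n @[n --> \oo] --> 0%E ->
    \forall n \near \oo, (a n <= 1)%E.
  move=> /fine_cvgP[afin /cvgr_le/(_ _ ltr01)]; move: afin; apply: filterS2 => n.
  by rewrite /=; case: (a n) => [r| |]//= _; rewrite lee_fin.
have {}h1 := E _ _ (fun i => H _ (h1 i)).
have {}h2 := E _ _ (fun i => H _ (h2 i)).
by move: h1 h2; apply: filterS2 => n.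
Qed.

Lemma data_cvg_cst g : data_cvg (fun=> g) g.
Proof.
have E (a : \bar R) : a = 0%E -> (fun _ : nat => a) n @[n --> \oo] --> 0%E.
  by move=> ->; exact: cvg_cst.
split=> i; apply: E.
- rewrite /norm2 (@eq_Lnorm _ _ _ _ _ _ (cst 0%E)); last by move=> x /=; rewrite subrr.
  by rewrite Lnorm0// gt_eqF// lte_fin.
- rewrite /norm1 (@eq_Lnorm _ _ _ _ _ _ (cst 0%E)); last by move=> x /=; rewrite subrr.
  by rewrite Lnorm0.
Qed.

Lemma data_near_refl g : data_near g g.
Proof. by have [n _ /(_ n (leqnn n))] := data_cvg_near (data_cvg_cst g). Qed.

Lemma data_cvg_subseq gn gd (phi : nat -> nat) :
  phi n @[n --> \oo] --> \oo -> data_cvg gn gd -> data_cvg (gn \o phi) gd.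
Proof.
move=> hphi [h1 h2]; split=> i.
- exact: (cvg_comp _ _ hphi (h1 i)).
- exact: (cvg_comp _ _ hphi (h2 i)).
Qed.

Lemma nr_term_lsc un u gn gd i : weak_cvg un u -> data_cvg gn gd ->
  (nr_term Tnr i u gd <= limn_einf (fun n => nr_term Tnr i (un n) (gn n)))%E.
Proof.
move=> unu [gg _]; apply: norm2_lsc => //.
- by move=> n; exact: integrableR_B.
- exact: integrableR_B.
have {gg}g1 : norm1 (nu i) (fun x => gd.1 i x - (gn n).1 i x) @[n --> \oo] --> 0%E.
  have [K K0 hK] := Lnorm_le_finite (nuT i) (lexx 1) (ler1n R 2).
  apply: (@squeeze_cvge _ _ _ _ (cst 0%E) _
    (fun n => K%:E * norm2 (nu i) (fun x => gd.1 i x - (gn n).1 i x)%R)%E).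
  - apply: nearW => n; rewrite Lnorm_ge0/=; apply: hK.
    exact: integrableR_measurable (integrableR_B (int_nr _) (int_nr _)).
  - exact: cvg_cst.
  - by rewrite -[X in _ --> X](mule0 K%:E); apply: cvgeZl => //; exact: gg.
have gw := weak_L1_cvg_strong (fun n => int_nr ((gn n).1 i)) (int_nr (gd.1 i)) g1.
have [_ [Tb _] _] := hNKL.
have Tw := weak_cvg_op (i := sval i) (nuT i) (Tb i) unu.
exact: weak_L1_cvgB Tw gw.
Qed.

Lemma kl_term_lsc un u gn gd i : weak_cvg un u -> data_cvg gn gd ->
  (kl_term Tkl c i u gd <= limn_einf (fun n => kl_term Tkl c i (un n) (gn n)))%E.
Proof.
move=> unu [_ gg]; apply: KL_lsc => //.
- by move=> n; exact: integrableR_D.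
- exact: integrableR_D.
- have [_ [_ Tb] _] := hNKL.
  have Tw := weak_cvg_op (q := 1) (i := sval i) (muT i) (Tb i) unu.
  have cw : weak_L1_cvg (mu i) (fun=> c i) (c i) by move=> phi _; exact: cvg_cst.
  exact: weak_L1_cvgD Tw cw.
- exact: weak_L1_cvg_strong.
Qed.

Lemma J_lsc un u gn gd : weak_cvg un u -> data_cvg gn gd ->
  (Jf gd u <= limn_einf (fun n => Jf (gn n) (un n)))%E.
Proof.
move=> unu gg; have [Rlsc _ _] := hNKL.
apply: limn_einf_geD => [n|n||].
- by rewrite adde_ge0// sume_ge0.
- by rewrite sume_ge0.
- apply: limn_einf_geD => // [n||]; first by rewrite sume_ge0.
  + exact: Rlsc.
  + by apply: limn_einf_ge_sum => // i; apply: limn_einf_geZ => //; exact: nr_term_lsc.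
- by apply: limn_einf_ge_sum => // i; apply: limn_einf_geZ => //; exact: kl_term_lsc.
Qed.

Lemma summand_le_J g u :
  [/\ (Reg u <= Jf g u)%E,
    forall i, ((lambda (sval i))%:E * nr_term Tnr i u g <= Jf g u)%E &
    forall i, ((lambda (sval i))%:E * kl_term Tkl c i u g <= Jf g u)%E].
Proof.
have s1 : (0 <= \sum_(i : idx Lnr) (lambda (sval i))%:E * nr_term Tnr i u g)%E.
  by rewrite sume_ge0.
have s2 : (0 <= \sum_(i : idx Lkl) (lambda (sval i))%:E * kl_term Tkl c i u g)%E.
  by rewrite sume_ge0.
rewrite /J; split=> [|i|i].
- by rewrite -addeA leeDl// adde_ge0.
- rewrite addeAC; apply: (le_trans _ (leeDr _ _)); last by rewrite adde_ge0.
  by rewrite (bigD1 i)//= leeDl// sume_ge0.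
- apply: (le_trans _ (leeDr _ _)); last by rewrite adde_ge0.
  by rewrite (bigD1 i)//= leeDl// sume_ge0.
Qed.

(** Each summand of J is at most M. For a squared norm this bounds T u - g in L^2,
    hence in L^p, and then T u as g is close to gd; for a divergence
    [norm1_le_KL] bounds T u + c in L^1. *)
Lemma coercive gd (M : R) : exists2 C : R, 0 < C & forall g u,
  data_near gd g -> (Jf g u <= M%:E)%E ->
  (Reg u + \sum_(i : idx Lnr) Lpnorm (Tnr i (u (sval i)))
     + \sum_(i : idx Lkl) Lpnorm (Tkl i (u (sval i))) < C%:E)%E.
Proof.
have Hnr (i : idx Lnr) : exists C : R, forall g u,
    data_near gd g -> (Jf g u <= M%:E)%E -> (Lpnorm (Tnr i (u (sval i))) <= C%:E)%E.
  have [K K0 hK] := Lnorm_le_finite (nuT i) (ltW p1) p2.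
  have mT w : measurable_fun setT (w : Lp (S (sval i)) p1).
    exact: Lspace_measurable.
  exists (K * (1 + (lambda (sval i))^-1 * M) + (K + fine (Lpnorm (gd.1 i)))).
  move=> g u [near_nr _] JM.
  have [_ /(_ i) + _] := summand_le_J g u; move=> /le_trans/(_ JM).
  rewrite -lee_pdivlMl// -EFinM => tM.
  have n2 : (norm2 (nu i) (fun x => Tnr i (u (sval i)) x - g.1 i x)%R <=
      (1 + (lambda (sval i))^-1 * M)%:E)%E.
    move: tM (Lnorm_ge0 (nu i) 2%:E
      (EFin \o (fun x => Tnr i (u (sval i)) x - g.1 i x)%R)).
    rewrite /nr_term /norm2; case: ('N[_]__[_])%E => [r| |]//=.
    rewrite -EFinM !lee_fin => tM r0; nra.
  rewrite !EFinD fineK; last exact: Lpnorm_fin.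
  apply: le_trans (Lnorm_triangle _ (ltW p1) (mT _) (mT (g.1 i))) _.
  apply: leeD.
    apply: (le_trans (hK _ (measurable_funB (mT _) (mT _)))).
    by rewrite EFinM lee_wpmul2l// lee_fin.
  apply: le_trans (Lnorm_triangle _ (ltW p1) (mT _) (mT (gd.1 i))) _.
  apply: leeD => //; rewrite Lnorm_distrC.
  apply: (le_trans (hK _ (measurable_funB (mT _) (mT _)))).
  rewrite -[leRHS]mule1 lee_wpmul2l ?lee_fin//; exact: near_nr.
have Hkl (i : idx Lkl) : exists C : R, forall g u,
    data_near gd g -> (Jf g u <= M%:E)%E -> (Lpnorm (Tkl i (u (sval i))) <= C%:E)%E.
  have mT (w : L1 (mu i)) : measurable_fun setT w.
    exact: integrableR_measurable (int_kl w).
  have f1 (w : L1 (mu i)) : norm1 (mu i) w \is a fin_num.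
    by rewrite Rintegral_norm.
  have le1 : (1 : R) <= 1 by [].
  exists (2 * ((lambda (sval i))^-1 * M) + 2 * ln 2 * (1 + fine (norm1 (mu i) (gd.2 i)))
    + fine (norm1 (mu i) (c i))).
  move=> g u [_ near_kl] JM.
  have [_ _ /(_ i) +] := summand_le_J g u; move=> /le_trans/(_ JM).
  rewrite -lee_pdivlMl// -EFinM => tM.
  rewrite EFinD [X in (_ <= _ + X)%E]fineK//.
  apply: le_trans (Lnorm_le_addr _ le1 (mT _) (mT (c i))) _.
  apply: leeD => //.
  apply: (le_trans (norm1_le_KL
    (integrableR_D (int_kl _) (int_kl (c i))) (int_kl (g.2 i)))).
  rewrite [leRHS]EFinD; apply: leeD.
    by rewrite EFinM lee_wpmul2l// lee_fin.
  rewrite [leRHS]EFinM lee_wpmul2l ?lee_fin ?mulr_ge0 ?ln_ge0 ?ler1n//.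
  rewrite EFinD fineK//.
  apply: le_trans (Lnorm_triangle _ le1 (mT _) (mT (gd.2 i))) _.
  by apply: leeD => //; rewrite Lnorm_distrC; exact: near_kl.
have [Cnr hCnr] := choice Hnr; have [Ckl hCkl] := choice Hkl.
exists (`|M + \sum_i Cnr i + \sum_i Ckl i| + 1); first by rewrite ltr_wpDl.
move=> g u gnear JM.
apply: (@le_lt_trans _ _ (M + \sum_i Cnr i + \sum_i Ckl i)%:E); last first.
  by rewrite lte_fin ltr_pwDr// ler_norm.
rewrite !EFinD -!sumEFin; apply: leeD;
  last by apply: lee_sum => i _; exact: hCkl gnear JM.
apply: leeD; last by apply: lee_sum => i _; exact: hCnr gnear JM.
by have [+ _ _] := summand_le_J g u; move=> /le_trans; apply.
Qed.

Lemma compactness gd (M : R) gn un :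
  (forall n, data_near gd (gn n)) -> (forall n, (Jf (gn n) (un n) <= M%:E)%E) ->
  exists phi u, subsequence phi /\ weak_cvg (un \o phi) u.
Proof.
move=> gnear JM; have [C C0 hC] := coercive gd M.
have [_ _ /(_ C un C0)] := hNKL; apply => n.
exact: hC (gnear n) (JM n).
Qed.

(** The direct method, along a sequence whose k-th term is optimal up to
    1/(k+1). *)
Lemma exists_minimizer g :
  proper_functional (Jf g) -> exists u, is_minimizer (Jf g) u.
Proof.
move=> [v Jv]; pose j := ereal_inf (range (Jf g)).
have j0 : (0 <= j)%E by apply: le_ereal_inf_tmp => _ [w _ <-]; exact: J_ge0.
have jle w : (j <= Jf g w)%E by apply: ereal_inf_lbound; exists w.
have jfin : j \is a fin_num by rewrite ge0_fin_numE// (le_lt_trans (jle v)).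
have /choice[un hun] : forall n : nat, exists u, (Jf g u < j + (n.+1%:R^-1)%:E)%E.
  move=> n; have e0 : (0 : R) < n.+1%:R^-1 by rewrite invr_gt0 ltr0n.
  by have [_ [w _ <-] ?] := lb_ereal_inf_adherent e0 jfin; exists w.
have JM n : (Jf g (un n) <= (fine j + 1)%:E)%E.
  rewrite EFinD fineK//; apply: (le_trans (ltW (hun n))); rewrite leeD2l// lee_fin.
  by rewrite invf_le1 ?ltr0n// ler1n.
have [phi [u [hphi unu]]] := compactness (fun=> data_near_refl g) JM.
exists u => w; apply: le_trans (jle w).
apply: (le_limn_einf_cvg (J_lsc unu (data_cvg_cst g))
  (v := fun n => (j + (n.+1%:R^-1)%:E)%E)).
  apply: nearW => n; apply: (le_trans (ltW (hun _))); rewrite leeD2l// lee_fin.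
  by rewrite lef_pV2 ?posrE ?ltr0n// ler_nat ltnS subsequence_ge.
rewrite -[X in _ --> X]adde0; apply: cvgeD;
  [by rewrite fin_num_adde_defl|exact: cvg_cst|].
apply: cvg_EFin; first exact: nearW.
exact: cvg_harmonic.
Qed.


(** J is split first into the divergences and the rest, then the rest into the
    regularizer and the squared norms; [cvg_summand] applies to each splitting. *)
Lemma terms_cvg un v gn gd (L : nat -> \bar R) : weak_cvg un v -> data_cvg gn gd ->
  (Jf gd v < +oo)%E -> (forall n, (Jf (gn n) (un n) <= L n)%E) ->
  L n @[n --> \oo] --> Jf gd v ->
  [/\ forall i, nr_term Tnr i (un n) (gn n) @[n --> \oo] --> nr_term Tnr i v gd,
    forall i, kl_term Tkl c i (un n) (gn n) @[n --> \oo] --> kl_term Tkl c i v gd &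
    Reg (un n) @[n --> \oo] --> Reg v].
Proof.
move=> unv gg Jvfin JL Lcvg.
pose An n :=
  (\sum_(i : idx Lnr) (lambda (sval i))%:E * nr_term Tnr i (un n) (gn n))%E.
pose Kn n :=
  (\sum_(i : idx Lkl) (lambda (sval i))%:E * kl_term Tkl c i (un n) (gn n))%E.
pose A := (\sum_(i : idx Lnr) (lambda (sval i))%:E * nr_term Tnr i v gd)%E.
pose K := (\sum_(i : idx Lkl) (lambda (sval i))%:E * kl_term Tkl c i v gd)%E.
have An0 n : (0 <= An n)%E by exact: sume_ge0.
have Kn0 n : (0 <= Kn n)%E by exact: sume_ge0.
have A0 : (0 <= A)%E by exact: sume_ge0.
have K0 : (0 <= K)%E by exact: sume_ge0.
have RAn0 n : (0 <= Reg (un n) + An n)%E by rewrite adde_ge0.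
have RA0 : (0 <= Reg v + A)%E by rewrite adde_ge0.
have [Rlsc _ _] := hNKL; have {}Rlsc := Rlsc _ _ unv.
have Anr i := limn_einf_geZ (hlambda (sval i)) (nr_term_lsc i unv gg).
have Kkl i := limn_einf_geZ (hlambda (sval i)) (kl_term_lsc i unv gg).
have Alsc : (A <= limn_einf An)%E by exact: limn_einf_ge_sum.
have Klsc : (K <= limn_einf Kn)%E by exact: limn_einf_ge_sum.
have RAlsc : (Reg v + A <= limn_einf (fun n => Reg (un n) + An n))%E.
  exact: limn_einf_geD.
have RAfin : (Reg v + A < +oo)%E by apply: le_lt_trans Jvfin; rewrite leeDl.
have Afin : (A < +oo)%E by apply: le_lt_trans RAfin; rewrite leeDr.
have Kfin : (K < +oo)%E by apply: le_lt_trans Jvfin; rewrite leeDr.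
have JL1 : \forall n \near \oo, (Reg (un n) + An n + Kn n <= L n)%E by exact: nearW.
have JL2 : \forall n \near \oo, (Kn n + (Reg (un n) + An n) <= L n)%E.
  by apply: nearW => n; rewrite addeC; exact: JL.
have RAcvg : (Reg (un n) + An n)%E @[n --> \oo] --> (Reg v + A)%E.
  exact: (cvg_summand RAn0 Kn0 RA0 K0 Jvfin RAlsc Klsc JL1 Lcvg).
have Kcvg : Kn n @[n --> \oo] --> K.
  have JvC : Jf gd v = (K + (Reg v + A))%E by rewrite addeC.
  rewrite JvC in Jvfin Lcvg.
  exact: (cvg_summand Kn0 RAn0 K0 RA0 Jvfin Klsc RAlsc JL2 Lcvg).
have self1 : \forall n \near \oo, (Reg (un n) + An n <= Reg (un n) + An n)%E.
  exact: nearW.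
have self2 : \forall n \near \oo, (An n + Reg (un n) <= Reg (un n) + An n)%E.
  by apply: nearW => n; rewrite addeC.
have Rcvg : Reg (un n) @[n --> \oo] --> Reg v.
  exact: (cvg_summand (fun n => hReg (un n)) An0 (hReg v) A0 RAfin Rlsc Alsc
    self1 RAcvg).
have Acvg : An n @[n --> \oo] --> A.
  rewrite addeC in RAfin; rewrite [(Reg v + A)%E]addeC in RAcvg.
  exact: (cvg_summand An0 (fun n => hReg (un n)) A0 (hReg v) RAfin Alsc Rlsc
    self2 RAcvg).
have unscale (k : R) (x : (\bar R)^nat) l : 0 < k ->
    (k%:E * x n)%E @[n --> \oo] --> (k%:E * l)%E -> x n @[n --> \oo] --> l.
  move=> k0; have kV y : (k^-1%:E * (k%:E * y) = y)%E.
    by rewrite muleA -EFinM mulVf ?mul1e// gt_eqF.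
  move=> /(cvgeZl (y := k^-1%:E) isT); rewrite kV.
  by under eq_fun do rewrite kV.
split=> // i; apply: (unscale (lambda (sval i))) => //.
- exact: (@cvg_summands _ (idx Lnr) _ _ (fun j n => lnr_ge0 j (un n) (gn n))
    (fun j => lnr_ge0 j v gd)
    Afin Anr Acvg i).
- exact: (@cvg_summands _ (idx Lkl) _ _ (fun j n => lkl_ge0 j (un n) (gn n))
    (fun j => lkl_ge0 j v gd)
    Kfin Kkl Kcvg i).
Qed.

Section Stability.
Variables (fn : nat -> data) (fd : data).
Hypothesis hfnr : forall i : idx Lnr,
  norm2 (nu i) (fun x => fd.1 i x - (fn n).1 i x) @[n --> \oo] --> 0%E.
Hypothesis hfkl : forall i : idx Lkl,
  (KL (mu i) (fd.2 i) ((fn n).2 i) +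
    norm1 (mu i) (fun x => fd.2 i x - (fn n).2 i x)%R)%E
    @[n --> \oo] --> 0%E.
Variable u0 : 'I_N -> Lp Om p1.
Hypothesis u0min : is_minimizer (Jf fd) u0.
Hypothesis Ju0 : (Jf fd u0 < +oo)%E.
Hypothesis u0ratio : forall i : idx Lkl, exists b0 b1 : R, [/\ 0 < b0, 0 < b1 &
  {ae mu i, forall x, b1 * fd.2 i x <= Tkl i (u0 (sval i)) x + c i x <= b0 * fd.2 i x}].
Variable un : nat -> 'I_N -> Lp Om p1.
Hypothesis unmin : forall n, is_minimizer (Jf (fn n)) (un n).

Lemma cvg_KL_data i : KL (mu i) (fd.2 i) ((fn n).2 i) @[n --> \oo] --> 0%E.
Proof.
apply: (@squeeze_cvge _ _ _ _ (cst 0%E) _ _ _ _ _ (hfkl i)); last exact: cvg_cst.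
by apply: nearW => n; rewrite (KL_ge0 (int_kl _) (int_kl _))/= leeDl// Lnorm_ge0.
Qed.

Lemma stable_data : data_cvg fn fd.
Proof.
split=> // i.
apply: (@squeeze_cvge _ _ _ _ (cst 0%E) _ _ _ _ _ (hfkl i)); last exact: cvg_cst.
by apply: nearW => n; rewrite Lnorm_ge0/= leeDr// (KL_ge0 (int_kl _) (int_kl _)).
Qed.

Lemma data_ae_ge0 i : ae_ge0 (mu i) (fd.2 i).
Proof.
have /fine_cvgP[[n _ /(_ n (leqnn n)) hn] _] := @cvg_KL_data i.
have [[]//|nn] := pselect (ae_ge0 (mu i) (fd.2 i) /\ ae_ge0 (mu i) ((fn n).2 i)).
by move: hn; rewrite /= /KL asboolF.
Qed.

(** The fixed competitor u0 is tested against all data. For the norms the upper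
    bound L comes from the triangle inequality, J(u0, fd) being finite; for the
    divergences the two-sided bound on T u0 + c makes [cvg_KL]
    available. *)
Lemma recovery : exists2 L : nat -> \bar R,
  (forall n, (Jf (fn n) u0 <= L n)%E) & L n @[n --> \oo] --> Jf fd u0.
Proof.
pose a i := norm2 (nu i) (fun x => Tnr i (u0 (sval i)) x - fd.1 i x).
pose e i n := norm2 (nu i) (fun x => fd.1 i x - (fn n).1 i x).
have [_ Jnr _] := summand_le_J fd u0.
have afin i : a i \is a fin_num.
  have : (nr_term Tnr i u0 fd < +oo)%E.
    have := le_lt_trans (Jnr i) Ju0; rewrite muleC -lte_pdivlMr//.
    by rewrite gt0_mulye// lte_fin invr_gt0.
  rewrite ge0_fin_numE ?Lnorm_ge0// /nr_term -/(a i).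
  have : (0 <= a i)%E by exact: Lnorm_ge0.
  by case: (a i) => // r _ _; rewrite ltry.
exists (fun n => Reg u0 + \sum_(i : idx Lnr) (lambda (sval i))%:E * (a i + e i n) ^+ 2
    + \sum_(i : idx Lkl) (lambda (sval i))%:E * kl_term Tkl c i u0 (fn n))%E.
  move=> n; apply: leeD => //; apply: leeD => //; apply: lee_sum => i _.
  apply: lee_wpmul2l; first by rewrite lee_fin ltW.
  rewrite /nr_term lee_sqr; [|exact: Lnorm_ge0|by rewrite adde_ge0 ?Lnorm_ge0].
  have mT (w : Lp (S (sval i)) p1) : measurable_fun setT w by exact: Lspace_measurable.
  have := @Lnorm_triangle _ _ _ (nu i) 2 (fun x => Tnr i (u0 (sval i)) x - (fn n).1 i x)
    (fun x => fd.1 i x - (fn n).1 i x) (ler1n R 2)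
    (measurable_funB (mT _) (mT _)) (measurable_funB (mT _) (mT _)).
  move=> /le_trans; apply; rewrite leeD2r// le_eqVlt; apply/orP; left; apply/eqP.
  by apply: eq_Lnorm => x /=; congr EFin; ring.
apply: cvgeD.
- by rewrite ge0_adde_def// inE ?adde_ge0 ?sume_ge0.
- apply: cvgeD; first by rewrite ge0_adde_def// inE ?sume_ge0.
    exact: cvg_cst.
  apply: cvg_nnesum => i _.
    apply: nearW => n; apply: mule_ge0; first by rewrite lee_fin ltW.
    by rewrite expe2; apply: mule_ge0; rewrite adde_ge0 ?Lnorm_ge0.
  apply: cvgeZl => //; rewrite /nr_term -/(a i) expe2.
  under eq_fun do rewrite expe2.
  have h : (a i + e i n)%E @[n --> \oo] --> a i.
    rewrite -[X in _ --> X]adde0; apply: cvgeD;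
      [by rewrite fin_num_adde_defl|exact: cvg_cst|exact: hfnr].
  by apply: cvgeM => //; exact: mule_def_fin.
- apply: cvg_nnesum => i _; first by apply: nearW => n.
  apply: cvgeZl => //.
  have [b0 [b1 [b00 b10 hb]]] := u0ratio i.
  have iv := integrableR_D (int_kl (Tkl i (u0 (sval i)))) (int_kl (c i)).
  have fw : weak_L1_cvg (mu i) (fun n => (fn n).2 i) (fd.2 i).
    by apply: weak_L1_cvg_strong => //; have [_ +] := stable_data; apply.
  exact: (cvg_KL iv (int_kl (fd.2 i)) b00 b10 (data_ae_ge0 i) hb
    (fun n => int_kl ((fn n).2 i)) fw (@cvg_KL_data i)).
Qed.

(** Along the sequence J is at most its value at the competitor u0, which is
    asymptotically at most the minimum of the limit problem. *)
Lemma weak_limit_minimizer (phi : nat -> nat) v : subsequence phi ->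
  weak_cvg (un \o phi) v -> is_minimizer (Jf fd) v.
Proof.
move=> hphi unv w; apply: le_trans (u0min w).
have [L JL Lcvg] := recovery; have phioo := cvg_subsequence hphi.
apply: (le_limn_einf_cvg (J_lsc unv (data_cvg_subseq phioo stable_data))
  (v := L \o phi)).
  by apply: nearW => n; apply: le_trans (unmin (phi n) u0) (JL _).
exact: cvg_comp phioo Lcvg.
Qed.

(** The functionals J(., f^n) may be infinite everywhere for small n, so
    compactness is applied to a shifted sequence. *)
Lemma minimizers_compact : exists phi v, subsequence phi /\ weak_cvg (un \o phi) v.
Proof.
have [L JL Lcvg] := recovery.
have jfin : Jf fd u0 \is a fin_num by rewrite ge0_fin_numE// J_ge0.
have LM : \forall n \near \oo, (L n <= (fine (Jf fd u0) + 1)%:E)%E.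
  move: Lcvg; rewrite -[X in _ --> X]fineK// => /fine_cvgP[Lfin].
  have j1 : fine (Jf fd u0) < fine (Jf fd u0) + 1 by rewrite ltrDl.
  move=> /cvgr_le/(_ _ j1); move: Lfin; apply: filterS2 => n.
  by rewrite /=; case: (L n) => [r| |]//= _; rewrite lee_fin.
have [n0 _ hn0] := LM; have [n1 _ hn1] := data_cvg_near stable_data.
pose s n := (n + (n0 + n1))%N.
have h1 n : data_near fd (fn (s n)) by apply: hn1; rewrite /s /= addnA leq_addl.
have h2 n : (Jf (fn (s n)) (un (s n)) <= (fine (Jf fd u0) + 1)%:E)%E.
  apply: le_trans (unmin (s n) u0) (le_trans (JL _) _).
  by apply: hn0; rewrite /s /= addnC -addnA leq_addr.
have [phi [v [hphi unv]]] := compactness h1 h2.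
exists (s \o phi), v; split=> // k l kl; rewrite /s /= ltn_add2r; exact: hphi.
Qed.

Lemma stability (phi : nat -> nat) v : subsequence phi -> weak_cvg (un \o phi) v ->
  [/\ forall i, nr_term Tnr i (un (phi n)) (fn (phi n)) @[n --> \oo] -->
        nr_term Tnr i v fd,
    forall i, kl_term Tkl c i (un (phi n)) (fn (phi n)) @[n --> \oo] -->
        kl_term Tkl c i v fd &
    Reg (un (phi n)) @[n --> \oo] --> Reg v].
Proof.
move=> hphi unv; have vmin := weak_limit_minimizer hphi unv.
have [L JL Lcvg] := recovery; have phioo := cvg_subsequence hphi.
have Jv : Jf fd v = Jf fd u0.
  by apply: le_anti; apply/andP; split; [exact: vmin|exact: u0min].
have Jvfin : (Jf fd v < +oo)%E by rewrite Jv.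
apply: (@terms_cvg (un \o phi) v (fn \o phi) fd (L \o phi) unv
  (data_cvg_subseq phioo stable_data) Jvfin).
- by move=> n; apply: le_trans (unmin (phi n) u0) (JL _).
- by rewrite Jv; exact: cvg_comp phioo Lcvg.
Qed.

End Stability.

End Functional.

Theorem proposition3p13 (R : realType) (N : nat) (Lnr Lkl : {set 'I_N})
  (hdisj : (Lnr :&: Lkl)%SET = finset.set0)
  (hcover : (Lnr :|: Lkl)%SET = finset.setTfor 'I_N)
  (d : nat) (Om : set 'rV[R]_d) (hOm : bounded_lipschitz_domain Om)
  (p : R) (p1 : 1 < p) (p2 : p <= 2)
  (Reg : ('I_N -> Lp Om p1) -> \bar R) (hReg : forall u, (0 <= Reg u)%E)
  (m : 'I_N -> nat) (S : forall i : 'I_N, set 'rV[R]_(m i))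
  (hSnr : forall i, i \in Lnr -> bounded_set (S i) /\ lebesgue_measurable (S i))
  (B : forall i : idx Lkl, set (set 'rV[R]_(m (sval i))))
  (hB : forall i : idx Lkl, sigma_algebra (S (sval i)) (B i))
  (mu : forall i : idx Lkl,
    {finite_measure set (g_sigma_algebraType (B i)) -> \bar R})
  (hmu : forall i : idx Lkl, mu i (~` S (sval i)) = 0%E)
  (c : forall i : idx Lkl, L1 (mu i))
  (hc : forall i : idx Lkl, ae_ge0 (mu i) (c i))
  (Tnr : forall i : idx Lnr, Lp Om p1 -> Lp (S (sval i)) p1)
  (Tkl : forall i : idx Lkl, Lp Om p1 -> L1 (mu i))
  (hNKL : assumption_NKL Reg Tnr Tkl)
  (f : nat -> data_space (Lnr := Lnr) (p1 := p1) (S := S) (mu := mu))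
  (fd : data_space (Lnr := Lnr) (p1 := p1) (S := S) (mu := mu))
  (hfnr : forall i : idx Lnr,
    norm2 (lebesgue_on (S (sval i))) (fun x => fd.1 i x - (f n).1 i x)
      @[n --> \oo] --> 0%E)
  (hfkl : forall i : idx Lkl,
    (KL (mu i) (fd.2 i) ((f n).2 i) +
      norm1 (mu i) (fun x => fd.2 i x - (f n).2 i x)%R)%E
      @[n --> \oo] --> 0%E)
  (lambda : 'I_N -> R) (hlambda : forall i, 0 < lambda i) :
  (forall n, proper_functional (J Reg Tnr Tkl c lambda (f n)) ->
     exists u, is_minimizer (J Reg Tnr Tkl c lambda (f n)) u) /\
  ((exists u0,
      [/\ is_minimizer (J Reg Tnr Tkl c lambda fd) u0,
        (J Reg Tnr Tkl c lambda fd u0 < +oo)%E &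
        forall i : idx Lkl, exists b0 b1 : R,
          [/\ 0 < b0, 0 < b1 &
            {ae mu i, forall x,
              b1 * fd.2 i x <= Tkl i (u0 (sval i)) x + c i x <= b0 * fd.2 i x}]]) ->
   forall u : nat -> 'I_N -> Lp Om p1,
     (forall n, is_minimizer (J Reg Tnr Tkl c lambda (f n)) (u n)) ->
     (exists (phi : nat -> nat) (ud : 'I_N -> Lp Om p1),
        subsequence phi /\
        [/\ weak_cvg (u \o phi) ud,
          forall i : idx Lnr,
            nr_term Tnr i (u (phi n)) (f (phi n)) @[n --> \oo] -->
              nr_term Tnr i ud fd,
          forall i : idx Lkl,
            kl_term Tkl c i (u (phi n)) (f (phi n)) @[n --> \oo] -->
              kl_term Tkl c i ud fd &
          Reg (u (phi n)) @[n --> \oo] --> Reg ud]) /\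
     (forall (phi : nat -> nat) (v : 'I_N -> Lp Om p1),
        subsequence phi -> weak_cvg (u \o phi) v ->
        is_minimizer (J Reg Tnr Tkl c lambda fd) v)).
Proof.
have hS (i : idx Lnr) : bounded_set (S (sval i)) by have [] := hSnr _ (svalP i).
split=> [n|[u0 [u0min Ju0 u0ratio]] u umin].
  exact: (exists_minimizer p2 hS hReg hNKL hlambda).
split=> [|phi v].
  have [phi [v [hphi uv]]] := minimizers_compact p2 hS hReg hNKL hlambda hfnr hfkl
    Ju0 u0ratio umin.
  have [hnr hkl hR] := stability hS hReg hNKL hlambda hfnr hfkl u0min Ju0 u0ratio umin
    hphi uv.
  by exists phi, v.
exact: (weak_limit_minimizer hS hReg hNKL hlambda hfnr hfkl u0min Ju0 u0ratio umin).
Qed.
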